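(* Let $\Bbbk$ be a field, let $\alpha\in\Bbbk^\times$, and let $B=B_K(\alpha)$ be the connected graded $\Bbbk$-algebra generated by the degree-one elements $x_1,x_2,y_1,y_2$ subject to the relations $$x_2x_1=-x_1x_2,\quad y_2y_1=-y_1y_2,\quad y_1x_1=x_1y_1,\quad y_1x_2=x_2y_2,\quad y_2x_1=x_1y_2,\quad y_2x_2=\alpha x_2y_1.$$ Let $k_B$ be the trivial right $B$-module, and let $M_x=B/(x_1B+x_2B)$ and $M_y=B/(y_1B+y_2B)$. Then the bigraded Poincaré series of these right $B$-modules are $$P_{k_B}^B(s,t)=1+4st+6s^2t^2+4s^3t^3+s^4t^4=(1+st)^4$$ and $$P_{M_x}^B(s,t)=P_{M_y}^B(s,t)=1+2st+s^2t^2=(1+st)^2.$$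
   Context: All modules are finitely generated graded right $B$-modules; $B=\bigoplus_{n\ge0}B_n$ is graded with $x_1,x_2,y_1,y_2$ in degree $1$, and $k_B=B/\bigoplus_{n\ge1}B_n$. The graded Betti numbers of a graded right module $M$ are $\beta_{i,j}^B(M)=\dim_\Bbbk\operatorname{Tor}_i^B(M,\Bbbk)_j$; equivalently, the $i$-th term of the minimal graded free resolution of $M$ is $\bigoplus_j B(-j)^{\beta_{i,j}^B(M)}$, where $B(-j)$ is the free right module of rank one with generator in degree $j$. The bigraded Poincaré series of $M$ over $B$ is $P_M^B(s,t)=\sum_{i\ge0}\sum_{j\in\mathbb{Z}}\beta_{i,j}^B(M)\,s^it^j$. *)

(* Defs.v *)
From HB Require Import structures.
From mathcomp Require Import all_boot all_order all_algebra.
From mathcomp Require Import boolp finmap.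
From mathcomp Require Import monalg.

Set Implicit Arguments.
Unset Strict Implicit.
Unset Printing Implicit Defensive.

Import GRing.Theory.
Local Open Scope ring_scope.

Definition two_sided (R : nzRingType) (J : R -> Prop) : Prop :=
  [/\ J 0, forall a b, J a -> J b -> J (a - b)
    & forall a b c, J b -> J (a * b * c)].

Definition right_ideal (R : nzRingType) (J : R -> Prop) : Prop :=
  [/\ J 0, forall a b, J a -> J b -> J (a - b) & forall b c, J b -> J (b * c)].

Definition gen_ideal (R : nzRingType) (S : R -> Prop) : {pred R} :=
  fun a => `[< forall J, two_sided J -> (forall s, S s -> J s) -> J a >].

Definition gen_rideal (R : nzRingType) (S : R -> Prop) : {pred R} :=
  fun a => `[< forall J, right_ideal J -> (forall s, S s -> J s) -> J a >].

Section GeneratedIdeals.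
Variables (R : nzRingType) (S : R -> Prop).

Lemma gen_idealP a :
  reflect (forall J, two_sided J -> (forall s, S s -> J s) -> J a)
          (a \in gen_ideal S).
Proof. exact: asboolP. Qed.

Lemma gen_ridealP a :
  reflect (forall J, right_ideal J -> (forall s, S s -> J s) -> J a)
          (a \in gen_rideal S).
Proof. exact: asboolP. Qed.

Lemma gen_ideal_zmod : zmod_closed (gen_ideal S).
Proof.
split=> [|a b /gen_idealP Ia /gen_idealP Ib].
  by apply/gen_idealP => J [].
apply/gen_idealP => J HJ SJ; case: (HJ) => _ + _.
by apply; [apply: Ia | apply: Ib].
Qed.

Lemma gen_idealM a b c : b \in gen_ideal S -> a * b * c \in gen_ideal S.
Proof.
move=> /gen_idealP Ib; apply/gen_idealP => J HJ SJ.
by case: (HJ) => _ _; apply; apply: Ib.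
Qed.

Lemma gen_rideal_zmod : zmod_closed (gen_rideal S).
Proof.
split=> [|a b /gen_ridealP Ia /gen_ridealP Ib].
  by apply/gen_ridealP => J [].
apply/gen_ridealP => J HJ SJ; case: (HJ) => _ + _.
by apply; [apply: Ia | apply: Ib].
Qed.

Lemma gen_ridealM b c : b \in gen_rideal S -> b * c \in gen_rideal S.
Proof.
move=> /gen_ridealP Ib; apply/gen_ridealP => J HJ SJ.
by case: (HJ) => _ _; apply; apply: Ib.
Qed.

HB.instance Definition _ := GRing.isZmodClosed.Build R (gen_ideal S)
  gen_ideal_zmod.
HB.instance Definition _ := GRing.isZmodClosed.Build R (gen_rideal S)
  gen_rideal_zmod.

End GeneratedIdeals.

(* A right R-module is an lmodType over the converse ring R^c, so that         *)
(* (r : R^c) *: m stands for the product m r; [cyclic_mod S] is R / SR.       *)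
Definition cyclic_mod (R : nzRingType) (S : R -> Prop) : Type :=
  Quotient.quot (gen_rideal S).

Section CyclicModule.
Variables (R : nzRingType) (S : R -> Prop).
Local Notation M := (cyclic_mod S).

HB.instance Definition _ := GRing.Zmodule.on M.

Definition cyclic_pi (b : R) : M := \pi%qT b.

Lemma cyclic_piP a b : reflect (cyclic_pi a = cyclic_pi b)
  (a - b \in gen_rideal S).
Proof. by rewrite Quotient.idealrBE; apply: eqP. Qed.

Lemma cyclic_piK (m : M) : cyclic_pi (repr m) = m.
Proof. by rewrite /cyclic_pi reprK. Qed.

Lemma cyclic_piD a b : cyclic_pi (a + b) = cyclic_pi a + cyclic_pi b.
Proof. by rewrite /cyclic_pi !piE. Qed.

Definition cyclic_act (r : R^c) (m : M) : M := cyclic_pi (repr m * (r : R)).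

Lemma cyclic_actE (r : R^c) b :
  cyclic_act r (cyclic_pi b) = cyclic_pi (b * (r : R)).
Proof.
apply/cyclic_piP; rewrite -mulrBl gen_ridealM //.
by apply/cyclic_piP; rewrite cyclic_piK.
Qed.

Lemma cyclic_actA a b v :
  cyclic_act a (cyclic_act b v) = cyclic_act (a * b) v.
Proof. by rewrite -[v]cyclic_piK !cyclic_actE -mulrA. Qed.

Lemma cyclic_act1 : left_id 1 cyclic_act.
Proof. by move=> v; rewrite -[v]cyclic_piK cyclic_actE mulr1. Qed.

Lemma cyclic_actDr : right_distributive cyclic_act +%R.
Proof.
move=> a u v; rewrite -[u]cyclic_piK -[v]cyclic_piK -cyclic_piD !cyclic_actE.
by rewrite mulrDl cyclic_piD.
Qed.

Lemma cyclic_actDl v : {morph cyclic_act^~ v : a b / a + b}.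
Proof.
by move=> a b; rewrite -[v]cyclic_piK !cyclic_actE mulrDr cyclic_piD.
Qed.

HB.instance Definition _ := GRing.Zmodule_isLmodule.Build R^c M
  cyclic_actA cyclic_act1 cyclic_actDr cyclic_actDl.

End CyclicModule.

Section Tor.
Variables (K : fieldType) (R : nzRingType).
(* [homog j r] : r lies in R_j. [eps] makes K the trivial left R-module. *)
Variables (homog : int -> R -> Prop) (eps : {rmorphism R -> K}).

Record gmodule := GModule {
  gsort :> lmodType R^c;
  gpart : int -> gsort -> Prop;
  gpart0 : forall j, gpart j 0;
  gpartB : forall j u v, gpart j u -> gpart j v -> gpart j (u - v);
  gpart_act : forall i j u (r : R),
    gpart i u -> homog j r -> gpart (i + j) ((r : R^c) *: u);
  gpart_sum : forall u, exists (s : seq int) (f : int -> gsort),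
    (forall j, gpart j (f j)) /\ u = \sum_(j <- s) f j;
  gpart_direct : forall (s : seq int) (f : int -> gsort), uniq s ->
    (forall j, gpart j (f j)) -> \sum_(j <- s) f j = 0 ->
    forall j, j \in s -> f j = 0
}.

(* Elements of the right module R^n are column vectors, and a matrix acts on  *)
(* them by left multiplication, which is right R-linear. The i-th term of the *)
(* resolution is \bigoplus_a R(- gdeg a), its a-th basis vector having degree *)
(* gdeg a; [diff i] goes from the (i+1)-st term to the i-th one, and [aug]    *)
(* gives the images in M of the basis vectors of the 0-th term.               *)
Record free_resolution (M : gmodule) :=
  FreeResolution {
    grank : nat -> nat;
    gdeg : forall i, 'I_(grank i) -> int;
    diff : forall i, 'M[R]_(grank i, grank i.+1);
    aug : 'I_(grank 0) -> M;
    aug_homog : forall a, gpart (gdeg a) (aug a);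
    diff_homog : forall i a b, homog (gdeg b - gdeg a) (diff i a b);
    aug_surj : forall m : M, exists v : 'cV[R]_(grank 0),
      m = \sum_a (v a 0 : R^c) *: aug a;
    exact_aug : forall v : 'cV[R]_(grank 0),
      \sum_a (v a 0 : R^c) *: aug a = 0 <-> exists w, v = diff 0 *m w;
    exact_diff : forall i (v : 'cV[R]_(grank i.+1)),
      diff i *m v = 0 <-> exists w, v = diff i.+1 *m w
  }.

Section TorDim.
Variables (M : gmodule) (F : free_resolution M).

(* R^n \otimes_R K = K^n, and the matrix D becomes that of the images of its  *)
(* entries under eps; basis vectors keep their degrees.                        *)
Definition diff_tensor i : 'Hom('cV[K]_(grank F i.+1), 'cV[K]_(grank F i)) :=
  linfun (mulmx (map_mx eps (diff F i))).

Definition tensor_part i (j : int) : {vspace 'cV[K]_(grank F i)} :=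
  <<[seq delta_mx a 0%R | a <- enum 'I_(grank F i) & gdeg a == j]>>%VS.

Definition cycles i (j : int) : {vspace 'cV[K]_(grank F i)} :=
  match i with
  | 0 => tensor_part 0 j
  | i'.+1 => (tensor_part i'.+1 j :&: lker (diff_tensor i'))%VS
  end.

Definition boundaries i (j : int) : {vspace 'cV[K]_(grank F i)} :=
  (diff_tensor i @: tensor_part i.+1 j)%VS.

Definition tor_dim i j : nat := \dim (cycles i j) - \dim (boundaries i j).

End TorDim.

(* Tor is computed from some resolution (it does not depend on which one);    *)
(* the value is 0 by convention if M has no resolution by free modules of     *)
(* finite rank.                                                               *)
Definition betti (M : gmodule) i j : nat :=
  if pselect (exists n, exists F : free_resolution M, tor_dim F i j = n)
    is left H then projT1 (cid H) else 0%N.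

(* P_M(s,t) through its coefficients: [poincare M i j] is that of s^i t^j *)
Definition poincare (M : gmodule) (i : nat) (j : int) : int := (betti M i j)%:Z.

End Tor.

(* The free algebra on x1, x2, y1, y2, encoded as the letters 0, 1, 2, 3. *)
Notation free4 K := {malg K[{fmonom 'I_4}]}.

Section Algebra.
Variables (K : fieldType) (alpha : K).

Definition letter (i : 'I_4) : free4 K := << fmu i >>.

Definition BK_rels : seq (free4 K) :=
  let x1 := letter (@Ordinal 4 0 isT) in
  let x2 := letter (@Ordinal 4 1 isT) in
  let y1 := letter (@Ordinal 4 2 isT) in
  let y2 := letter (@Ordinal 4 3 isT) in
  [:: x2 * x1 - (- (x1 * x2));
      y2 * y1 - (- (y1 * y2));
      y1 * x1 - x1 * y1;
      y1 * x2 - x2 * y2;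
      y2 * x1 - x1 * y2;
      y2 * x2 - alpha *: (x2 * y1)].

Definition BK_ideal : {pred free4 K} := gen_ideal [in BK_rels].

HB.instance Definition _ := GRing.ZmodClosed.on BK_ideal.

Definition BK : Type := Quotient.quot BK_ideal.

HB.instance Definition _ := GRing.Zmodule.on BK.

Definition BK_pi (f : free4 K) : BK := \pi%qT f.

Lemma BK_piP f g : reflect (BK_pi f = BK_pi g) (f - g \in BK_ideal).
Proof. by rewrite Quotient.idealrBE; apply: eqP. Qed.

Lemma BK_piK (b : BK) : BK_pi (repr b) = b.
Proof. by rewrite /BK_pi reprK. Qed.

Lemma BK_piD f g : BK_pi (f + g) = BK_pi f + BK_pi g.
Proof. by rewrite /BK_pi !piE. Qed.

Lemma BK_pi0 : BK_pi 0 = 0.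
Proof. by rewrite /BK_pi !piE. Qed.

Lemma free4_scalerAr (c : K) (f g : free4 K) : c *: (f * g) = f * (c *: g).
Proof.
have Zc h : c *: h = h * c%:MP :> free4 K.
  rewrite -mul_malgC !malgM_def fgmulUg fgmulgU.
  by apply: eq_bigr => k _; rewrite mulrC mul1m mulm1.
by rewrite !Zc mulrA.
Qed.

Lemma free4_augM (f g : free4 K) : (f * g)@_mone = f@_mone * g@_mone.
Proof. exact: (rmorphM (@mcoeff _ K (mone : {fmonom 'I_4}))). Qed.

Lemma letterM0 i j : (letter i * letter j)@_mone = 0.
Proof.
by rewrite malgM_def fgmulUU mcoeffU fmM_eq1 !fm1_eq1 mulr0n.
Qed.

Lemma BK_rels_aug : all (fun f : free4 K => f@_mone == 0) BK_rels.
Proof.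
have augB (f g : free4 K) : f@_mone = 0 -> g@_mone = 0 -> (f - g)@_mone == 0.
  by move=> f0 g0; rewrite mcoeffB f0 g0 subrr.
have augN (f : free4 K) : f@_mone = 0 -> (- f)@_mone = 0.
  by move=> f0; rewrite mcoeffN f0 oppr0.
have augZ (f : free4 K) : f@_mone = 0 -> (alpha *: f)@_mone = 0.
  by move=> f0; rewrite mcoeffZ f0 mulr0.
apply/and5P; split; [| | | |apply/and3P; split=> //].
- exact: (augB _ _ (letterM0 _ _) (augN _ (letterM0 _ _))).
- exact: (augB _ _ (letterM0 _ _) (augN _ (letterM0 _ _))).
- exact: (augB _ _ (letterM0 _ _) (letterM0 _ _)).
- exact: (augB _ _ (letterM0 _ _) (letterM0 _ _)).
- exact: (augB _ _ (letterM0 _ _) (letterM0 _ _)).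
- exact: (augB _ _ (letterM0 _ _) (augZ _ (letterM0 _ _))).
Qed.

Lemma BK_ideal_aug f : f \in BK_ideal -> f@_mone = 0.
Proof.
move=> /gen_idealP/(_ (fun g => g@_mone = 0)); apply; first split.
- exact: mcoeff0.
- by move=> a b a0 b0; rewrite mcoeffB a0 b0 subr0.
- by move=> a b c b0; rewrite !free4_augM b0 mulr0 mul0r.
by move=> s /(allP BK_rels_aug)/eqP.
Qed.

Definition BK_one : BK := BK_pi 1.
Definition BK_mul (a b : BK) : BK := BK_pi (repr a * repr b).
Definition BK_scale (c : K) (b : BK) : BK := BK_pi (c *: repr b).

Lemma BK_mulE f g : BK_mul (BK_pi f) (BK_pi g) = BK_pi (f * g).
Proof.
apply/BK_piP; set f' := repr _; set g' := repr _.
have If : f' - f \in BK_ideal by apply/BK_piP; rewrite BK_piK.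
have Ig : g' - g \in BK_ideal by apply/BK_piP; rewrite BK_piK.
have -> : f' * g' - f * g = 1 * (f' - f) * g' + f * (g' - g) * 1.
  by rewrite mul1r mulr1 mulrBl mulrBr addrA subrK.
by rewrite rpredD // gen_idealM.
Qed.

Lemma BK_scaleE c f : BK_scale c (BK_pi f) = BK_pi (c *: f).
Proof.
apply/BK_piP; rewrite -scalerBr -mul_malgC -[_ * _]mulr1.
by apply: gen_idealM; apply/BK_piP; rewrite BK_piK.
Qed.

Lemma BK_mulA : associative BK_mul.
Proof.
move=> a b c; rewrite -[a]BK_piK -[b]BK_piK -[c]BK_piK.
by rewrite !BK_mulE mulrA.
Qed.

Lemma BK_mul1l : left_id BK_one BK_mul.
Proof. by move=> a; rewrite -[a]BK_piK BK_mulE mul1r. Qed.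

Lemma BK_mul1r : right_id BK_one BK_mul.
Proof. by move=> a; rewrite -[a]BK_piK BK_mulE mulr1. Qed.

Lemma BK_mulDl : left_distributive BK_mul +%R.
Proof.
move=> a b c; rewrite -[a]BK_piK -[b]BK_piK -[c]BK_piK.
by rewrite -BK_piD !BK_mulE mulrDl BK_piD.
Qed.

Lemma BK_mulDr : right_distributive BK_mul +%R.
Proof.
move=> a b c; rewrite -[a]BK_piK -[b]BK_piK -[c]BK_piK.
by rewrite -BK_piD !BK_mulE mulrDr BK_piD.
Qed.

Lemma BK_one_neq0 : BK_one != 0.
Proof.
rewrite -BK_pi0; apply/eqP => /BK_piP; rewrite subr0 => /BK_ideal_aug/eqP.
by rewrite mcoeff1 eqxx oner_eq0.
Qed.

HB.instance Definition _ := GRing.Zmodule_isNzRing.Build BK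
  BK_mulA BK_mul1l BK_mul1r BK_mulDl BK_mulDr BK_one_neq0.

Lemma BK_scaleA a b v : BK_scale a (BK_scale b v) = BK_scale (a * b) v.
Proof. by rewrite -[v]BK_piK !BK_scaleE scalerA. Qed.

Lemma BK_scale1 : left_id 1 BK_scale.
Proof. by move=> v; rewrite -[v]BK_piK BK_scaleE scale1r. Qed.

Lemma BK_scaleDr : right_distributive BK_scale +%R.
Proof.
move=> c u v; rewrite -[u]BK_piK -[v]BK_piK -BK_piD !BK_scaleE.
by rewrite scalerDr BK_piD.
Qed.

Lemma BK_scaleDl v : {morph BK_scale^~ v : a b / a + b}.
Proof. by move=> a b; rewrite -[v]BK_piK !BK_scaleE scalerDl BK_piD. Qed.

HB.instance Definition _ := GRing.Zmodule_isLmodule.Build K BK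
  BK_scaleA BK_scale1 BK_scaleDr BK_scaleDl.

Lemma BK_scaleAl (c : K) (a b : BK) : c *: (a * b) = (c *: a) * b.
Proof.
rewrite -[a]BK_piK -[b]BK_piK.
by rewrite /GRing.scale /GRing.mul /= !(BK_mulE, BK_scaleE) scalerAl.
Qed.

Lemma BK_scaleAr (c : K) (a b : BK) : c *: (a * b) = a * (c *: b).
Proof.
rewrite -[a]BK_piK -[b]BK_piK.
by rewrite /GRing.scale /GRing.mul /= !(BK_mulE, BK_scaleE) free4_scalerAr.
Qed.

HB.instance Definition _ := GRing.Lmodule_isLalgebra.Build K BK BK_scaleAl.
HB.instance Definition _ := GRing.Lalgebra_isAlgebra.Build K BK BK_scaleAr.

Definition BK_x1 : BK := BK_pi (letter (@Ordinal 4 0 isT)).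
Definition BK_x2 : BK := BK_pi (letter (@Ordinal 4 1 isT)).
Definition BK_y1 : BK := BK_pi (letter (@Ordinal 4 2 isT)).
Definition BK_y2 : BK := BK_pi (letter (@Ordinal 4 3 isT)).

Definition free4_homog (j : int) (f : free4 K) : Prop :=
  forall w, w \in msupp f -> (fdeg w)%:Z = j.

(* B_j for j : int; it is 0 when j < 0 *)
Definition BK_homog (j : int) (b : BK) : Prop :=
  exists2 f : free4 K, free4_homog j f & b = BK_pi f.

(* the augmentation B -> K with kernel \bigoplus_(n >= 1) B_n *)
Definition BK_eps (b : BK) : K := (repr b)@_mone.

Lemma BK_epsE f : BK_eps (BK_pi f) = f@_mone.
Proof.
apply/eqP; rewrite -subr_eq0 -mcoeffB; apply/eqP/BK_ideal_aug/BK_piP.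
by rewrite BK_piK.
Qed.

Lemma BK_eps_zmod : zmod_morphism BK_eps.
Proof.
move=> a b; rewrite -[a]BK_piK -[b]BK_piK.
have -> : BK_pi (repr a) - BK_pi (repr b) = BK_pi (repr a - repr b).
  by rewrite /BK_pi !piE.
by rewrite !BK_epsE mcoeffB.
Qed.

Lemma BK_eps_monoid : monoid_morphism BK_eps.
Proof.
split=> [|a b]; first by rewrite BK_epsE mcoeff1 eqxx.
rewrite -[a]BK_piK -[b]BK_piK /GRing.mul /= BK_mulE !BK_epsE.
exact: free4_augM.
Qed.

HB.instance Definition _ := GRing.isZmodMorphism.Build BK K BK_eps BK_eps_zmod.
HB.instance Definition _ := GRing.isMonoidMorphism.Build BK K BK_eps
  BK_eps_monoid.

Definition free4_comp (j : int) (f : free4 K) : free4 K :=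
  [malg w in msupp f => if (fdeg w)%:Z == j then f@_w else 0].

Lemma free4_compE j f w :
  (free4_comp j f)@_w = if (fdeg w)%:Z == j then f@_w else 0.
Proof. by rewrite mcoeffE; case: msuppP => // _; case: ifP. Qed.

Lemma free4_compB j f g :
  free4_comp j (f - g) = free4_comp j f - free4_comp j g.
Proof.
apply/malgP => w; rewrite mcoeffB !free4_compE mcoeffB.
by case: ifP => // _; rewrite subr0.
Qed.

Lemma free4_comp_homog j f : free4_homog j (free4_comp j f).
Proof.
move=> w; rewrite -mcoeff_neq0 free4_compE.
by case: ifP => [/eqP // | _]; rewrite eqxx.
Qed.

Lemma free4_comp_id i j f : free4_homog j f ->
  free4_comp i f = if i == j then f else 0.
Proof.
move=> fj; apply/malgP => w; rewrite free4_compE.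
case: (msuppP f w) => [/fj -> | wf].
  by rewrite eq_sym; case: eqP => // _; rewrite mcoeff0.
by case: eqP => _; case: eqP => _ //; rewrite ?(mcoeff_outdom wf) ?mcoeff0.
Qed.

Lemma free4_sum f : exists2 s : seq int, uniq s
  & f = \sum_(j <- s) free4_comp j f.
Proof.
pose s := undup [seq (fdeg w)%:Z | w <- msupp f].
exists s; first exact: undup_uniq.
apply/malgP => w; rewrite raddf_sum /=.
case: (boolP (w \in msupp f)) => [wf | wf].
  have ws : (fdeg w)%:Z \in s by rewrite mem_undup map_f.
  rewrite (bigD1_seq _ ws (undup_uniq _)) /= free4_compE eqxx big1 ?addr0 //.
  by move=> j /negPf jw; rewrite free4_compE eq_sym jw.
rewrite (mcoeff_outdom wf) big1 // => j _.
by rewrite free4_compE (mcoeff_outdom wf); case: ifP.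
Qed.

Lemma free4_homogM i j f g : free4_homog i f -> free4_homog j g ->
  free4_homog (i + j) (f * g).
Proof.
move=> fi gj w /msuppM_le [u [v [/fi <- /gj <- ->]]].
by rewrite fdegM PoszD.
Qed.

Lemma free4_comp0 j : free4_comp j 0 = 0.
Proof. by rewrite -[in LHS](subrr 0) free4_compB subrr. Qed.

Lemma free4_compN j f : free4_comp j (- f) = - free4_comp j f.
Proof. by rewrite -[- f]sub0r free4_compB free4_comp0 sub0r. Qed.

Lemma free4_compD j f g :
  free4_comp j (f + g) = free4_comp j f + free4_comp j g.
Proof. by rewrite -{1}[g]opprK free4_compB free4_compN opprK. Qed.

Lemma free4_comp_sum j (I : Type) (r : seq I) (F : I -> free4 K) :
  free4_comp j (\sum_(i <- r) F i) = \sum_(i <- r) free4_comp j (F i).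
Proof. exact: (big_morph _ (free4_compD j) (free4_comp0 j)). Qed.

Lemma free4_compMr j e f g : free4_homog e g ->
  free4_comp j (f * g) = free4_comp (j - e) f * g.
Proof.
move=> ge; have [s _ ->] := free4_sum f.
rewrite mulr_suml !free4_comp_sum mulr_suml; apply: eq_bigr => p _.
have fp := @free4_comp_homog p f.
rewrite (free4_comp_id _ fp) (free4_comp_id _ (free4_homogM fp ge)).
by rewrite subr_eq; case: eqP; rewrite ?mul0r.
Qed.

Lemma free4_compMl j e f g : free4_homog e g ->
  free4_comp j (g * f) = g * free4_comp (j - e) f.
Proof.
move=> ge; have [s _ ->] := free4_sum f.
rewrite mulr_sumr !free4_comp_sum mulr_sumr; apply: eq_bigr => p _.
have fp := @free4_comp_homog p f.
rewrite (free4_comp_id _ fp) (free4_comp_id _ (free4_homogM ge fp)).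
by rewrite subr_eq addrC; case: eqP; rewrite ?mulr0.
Qed.

Lemma letter_homog i : free4_homog 1 (letter i).
Proof. by move=> w; rewrite msuppU1 in_fset1 => /eqP ->; rewrite fdegU. Qed.

Lemma free4_homogB j f g : free4_homog j f -> free4_homog j g ->
  free4_homog j (f - g).
Proof.
move=> fj gj w; rewrite -mcoeff_neq0 mcoeffB.
case: (msuppP f w) => [/fj //|_]; case: (msuppP g w) => [/gj //|_].
by rewrite subr0 eqxx.
Qed.

Lemma free4_homogN j f : free4_homog j f -> free4_homog j (- f).
Proof. by move=> fj w; rewrite msuppN; apply: fj. Qed.

Lemma free4_homogZ j c f : free4_homog j f -> free4_homog j (c *: f).
Proof. by move=> fj w /(fsubsetP (msuppZ_le _ _)); apply: fj. Qed.

Lemma BK_rels_homog f : f \in BK_rels -> free4_homog 2 f.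
Proof.
have ll i j : free4_homog 2 (letter i * letter j).
  exact: (free4_homogM (@letter_homog i) (@letter_homog j)).
rewrite /BK_rels /=.
rewrite in_cons => /predU1P [->|].
  exact: (free4_homogB (ll _ _) (free4_homogN (ll _ _))).
rewrite in_cons => /predU1P [->|].
  exact: (free4_homogB (ll _ _) (free4_homogN (ll _ _))).
rewrite in_cons => /predU1P [->|]; first exact: (free4_homogB (ll _ _) (ll _ _)).
rewrite in_cons => /predU1P [->|]; first exact: (free4_homogB (ll _ _) (ll _ _)).
rewrite in_cons => /predU1P [->|]; first exact: (free4_homogB (ll _ _) (ll _ _)).
rewrite mem_seq1 => /eqP ->.
exact: (free4_homogB (ll _ _) (free4_homogZ (ll _ _))).
Qed.

Lemma BK_ideal_comp j f : f \in BK_ideal -> free4_comp j f \in BK_ideal.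
Proof.
move=> /gen_idealP If.
suff: forall i, free4_comp i f \in BK_ideal by apply.
apply: (If (fun f => forall i, free4_comp i f \in BK_ideal)).
  split=> [i | a b Ia Ib i | a b c Ib i].
  - by rewrite free4_comp0 rpred0.
  - by rewrite free4_compB; apply: (rpredB (Ia i) (Ib i)).
  - have [s _ {1}->] := free4_sum a; have [t _ {1}->] := free4_sum c.
    rewrite (mulr_suml s xpredT (free4_comp^~ a) b) (mulr_suml s xpredT).
    rewrite free4_comp_sum; apply: rpred_sum => p _.
    rewrite (mulr_sumr t xpredT (free4_comp^~ c)).
    rewrite free4_comp_sum; apply: rpred_sum => q _.
    rewrite (free4_compMr _ _ (@free4_comp_homog q c)).
    rewrite (free4_compMl _ _ (@free4_comp_homog p a)).
    by apply: gen_idealM; apply: Ib.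
move=> g gr i; rewrite (free4_comp_id _ (BK_rels_homog gr)).
case: ifP => _; last by rewrite rpred0.
by apply/gen_idealP => J _; apply.
Qed.

Definition BK_comp (j : int) (b : BK) : BK := BK_pi (free4_comp j (repr b)).

Lemma BK_compE j f : BK_comp j (BK_pi f) = BK_pi (free4_comp j f).
Proof.
apply/BK_piP; rewrite -free4_compB; apply: BK_ideal_comp.
by apply/BK_piP; rewrite BK_piK.
Qed.

Lemma BK_piB f g : BK_pi (f - g) = BK_pi f - BK_pi g.
Proof. by rewrite /BK_pi !piE. Qed.

Lemma BK_piM f g : BK_pi (f * g) = BK_pi f * BK_pi g.
Proof. by rewrite -BK_mulE. Qed.

Lemma BK_compD j : {morph BK_comp j : a b / a + b}.
Proof.
move=> a b; rewrite -[a]BK_piK -[b]BK_piK.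
by rewrite -BK_piD !BK_compE free4_compD BK_piD.
Qed.

Lemma BK_compB j : {morph BK_comp j : a b / a - b}.
Proof.
move=> a b; rewrite -[a]BK_piK -[b]BK_piK.
by rewrite -BK_piB !BK_compE free4_compB BK_piB.
Qed.

Lemma BK_comp0 j : BK_comp j 0 = 0.
Proof. by rewrite -BK_pi0 BK_compE free4_comp0. Qed.

Lemma BK_comp_homog j b : BK_homog j (BK_comp j b).
Proof. by exists (free4_comp j (repr b)) => //; apply: free4_comp_homog. Qed.

Lemma BK_comp_id i j b : BK_homog j b -> BK_comp i b = if i == j then b else 0.
Proof.
case=> f fj ->; rewrite BK_compE (free4_comp_id _ fj).
by case: eqP => _; rewrite ?BK_pi0.
Qed.

Lemma BK_sum b : exists2 s : seq int, uniq s & b = \sum_(j <- s) BK_comp j b.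
Proof.
have [s us fE] := free4_sum (repr b); exists s => //.
by rewrite -{1}[b]BK_piK {1}fE (big_morph _ BK_piD BK_pi0).
Qed.

Lemma BK_homogM i j a b : BK_homog i a -> BK_homog j b -> BK_homog (i + j) (a * b).
Proof.
case=> f fi -> [g gj ->]; exists (f * g); last by rewrite BK_piM.
exact: free4_homogM.
Qed.

Lemma BK_homogB j a b : BK_homog j a -> BK_homog j b -> BK_homog j (a - b).
Proof.
case=> f fi -> [g gj ->]; exists (f - g); last by rewrite BK_piB.
exact: free4_homogB.
Qed.

Lemma BK_homog0 j : BK_homog j 0.
Proof. by exists 0; rewrite ?BK_pi0 // => w; rewrite msupp0 in_fset0. Qed.

Lemma BK_compMr j e a b : BK_homog e b -> BK_comp j (a * b) = BK_comp (j - e) a * b.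
Proof.
case=> g ge ->; rewrite -[a]BK_piK -BK_piM !BK_compE.
by rewrite (free4_compMr _ _ ge) BK_piM.
Qed.

Section CyclicGraded.
Variables (S : BK -> Prop) (homS : forall b, S b -> exists j, BK_homog j b).

Definition cyclic_homog (j : int) (m : cyclic_mod S) : Prop :=
  exists2 b : BK, BK_homog j b & m = cyclic_pi S b.

Lemma cyclic_pi0 : cyclic_pi S 0 = 0.
Proof. by apply: (addrI (cyclic_pi S 0)); rewrite -cyclic_piD !addr0. Qed.

Lemma cyclic_piB a b : cyclic_pi S (a - b) = cyclic_pi S a - cyclic_pi S b.
Proof. by apply: (addIr (cyclic_pi S b)); rewrite -cyclic_piD !subrK. Qed.

Lemma cyclic_scaleE (r b : BK) :
  (r : BK^c) *: cyclic_pi S b = cyclic_pi S (b * r).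
Proof. exact: cyclic_actE. Qed.

Lemma gen_rideal_comp j b : b \in gen_rideal S -> BK_comp j b \in gen_rideal S.
Proof.
move=> /gen_ridealP Ib.
suff: forall i, BK_comp i b \in gen_rideal S by apply.
apply: (Ib (fun b => forall i, BK_comp i b \in gen_rideal S)).
  split=> [i | a c Ia Ic i | a c Ia i].
  - by rewrite BK_comp0 rpred0.
  - by rewrite BK_compB rpredB.
  - have [s _ ->] := BK_sum c.
    rewrite mulr_sumr (big_morph _ (BK_compD i) (BK_comp0 i)) rpred_sum // => p _.
    rewrite (BK_compMr _ _ (BK_comp_homog p c)).
    by apply: gen_ridealM; apply: Ia.
move=> a Sa i; have [e ae] := homS Sa; rewrite (BK_comp_id _ ae).
case: ifP => _; last by rewrite rpred0.
by apply/gen_ridealP => J _; apply.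
Qed.

Lemma cyclic_homog0 j : cyclic_homog j 0.
Proof. by exists 0; rewrite ?cyclic_pi0 //; apply: BK_homog0. Qed.

Lemma cyclic_homogB j u v :
  cyclic_homog j u -> cyclic_homog j v -> cyclic_homog j (u - v).
Proof.
case=> a aj -> [b bj ->]; exists (a - b); last by rewrite cyclic_piB.
exact: BK_homogB.
Qed.

Lemma cyclic_homog_act i j u (r : BK) :
  cyclic_homog i u -> BK_homog j r -> cyclic_homog (i + j) ((r : BK^c) *: u).
Proof.
case=> a ai -> rj; exists (a * r); last by rewrite cyclic_scaleE.
exact: BK_homogM.
Qed.

Lemma cyclic_homog_sum u : exists (s : seq int) (f : int -> cyclic_mod S),
  (forall j, cyclic_homog j (f j)) /\ u = \sum_(j <- s) f j.
Proof.
have [s _ uE] := BK_sum (repr u).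
exists s, (fun j => cyclic_pi S (BK_comp j (repr u))); split.
  by move=> j; exists (BK_comp j (repr u)) => //; apply: BK_comp_homog.
by rewrite -(big_morph _ (@cyclic_piD _ S) cyclic_pi0) -uE cyclic_piK.
Qed.

Lemma cyclic_homog_direct (s : seq int) (f : int -> cyclic_mod S) : uniq s ->
  (forall j, cyclic_homog j (f j)) -> \sum_(j <- s) f j = 0 ->
  forall j, j \in s -> f j = 0.
Proof.
move=> us fh s0 i si.
have /choice [b bP] : forall j, exists b, BK_homog j b /\ f j = cyclic_pi S b.
  by move=> j; have [b bj fj] := fh j; exists b.
have : \sum_(j <- s) b j \in gen_rideal S.
  rewrite -[\sum_(_ <- _) _]subr0; apply/cyclic_piP.
  rewrite cyclic_pi0 -s0 (big_morph _ (@cyclic_piD _ S) cyclic_pi0).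
  by apply: eq_bigr => j _; rewrite (bP j).2.
move=> /(gen_rideal_comp i); rewrite (big_morph _ (BK_compD i) (BK_comp0 i)).
rewrite (bigD1_seq _ si us) /= (BK_comp_id _ (bP i).1) eqxx big1 ?addr0.
  by rewrite -[b i]subr0 => /cyclic_piP; rewrite cyclic_pi0 -(bP i).2.
by move=> j /negPf ji; rewrite (BK_comp_id _ (bP j).1) eq_sym ji.
Qed.

Definition cyclic_gmodule : gmodule BK_homog :=
  GModule cyclic_homog0 cyclic_homogB cyclic_homog_act cyclic_homog_sum
    cyclic_homog_direct.

End CyclicGraded.

Lemma BK_letter_homog i : BK_homog 1 (BK_pi (letter i)).
Proof. by exists (letter i) => //; apply: letter_homog. Qed.

(* \bigoplus_(n >= 1) B_n is the right ideal generated by the B_n, n >= 1 *)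
Definition BK_pos (b : BK) : Prop := exists2 n : nat, (0 < n)%N & BK_homog n b.
Definition BK_xs (b : BK) : Prop := b = BK_x1 \/ b = BK_x2.
Definition BK_ys (b : BK) : Prop := b = BK_y1 \/ b = BK_y2.

Lemma BK_pos_homog b : BK_pos b -> exists j, BK_homog j b.
Proof. by case=> n _ bn; exists n%:Z. Qed.

Lemma BK_xs_homog b : BK_xs b -> exists j, BK_homog j b.
Proof. by case=> ->; exists 1; apply: BK_letter_homog. Qed.

Lemma BK_ys_homog b : BK_ys b -> exists j, BK_homog j b.
Proof. by case=> ->; exists 1; apply: BK_letter_homog. Qed.

Definition k_B : gmodule BK_homog := cyclic_gmodule BK_pos_homog.
Definition M_x : gmodule BK_homog := cyclic_gmodule BK_xs_homog.
Definition M_y : gmodule BK_homog := cyclic_gmodule BK_ys_homog.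

End Algebra.

(* Z[s,t] is represented as Z[t][s]; [coef_st p i j] is the coefficient of   *)
(* s^i t^j, for an arbitrary integer j.                                       *)
Definition svar : {poly {poly int}} := 'X.
Definition tvar : {poly {poly int}} := ('X)%:P.

Definition coef_st (p : {poly {poly int}}) (i : nat) (j : int) : int :=
  if j is Posz n then p`_i`_n else 0.

(* Main.v *)
From HB Require Import structures.
Require Import Defs.
From mathcomp Require Import all_boot all_order all_algebra.
From mathcomp Require Import boolp finmap monalg ring.

Set Implicit Arguments.
Unset Strict Implicit.
Unset Printing Implicit Defensive.

Import GRing.Theory.
Local Open Scope ring_scope.

(** The idea is that B is an iterated Ore extension in disguise, so that it
    behaves like a polynomial ring in four variables: its Koszul complexes are
    linear free resolutions, and the Betti numbers are read off their ranks.

    Three ingredients carry the proof. The first is the comparison theorem for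
    graded free resolutions ([tor_dim_indep]): degree-preserving comparison
    maps and homotopies survive tensoring with the residue field, so Tor may be
    computed from any resolution. If moreover the i-th free module is generated
    in degree i, every differential dies in the tensor product, and the i-th
    Betti number is the rank of the i-th term, placed in degree i
    ([betti_linear]).

    The second is a substitute for a monomial basis of B. Exactness of Koszul
    complexes is proved with operators that divide on the left by a generator,
    such as an additive D1 with D1(x1 b) = b and D1(x2 b) = - x2 D1(b). They
    exist because B is the universal left module on one generator: a map out of
    B^1 into B^3 sending b to (b, D1 b, D2 b) only requires four operators on
    B^3 that satisfy the six relations ([x_derivations], [y_derivations]).
    Applying the division operators to x1 a + x2 b = 0 gives (a, b) = (x2, x1)c,
    which resolves M_x; the same works for y1, y2, where dividing through x2
    exchanges the two operators and brings in the inverse of alpha. Since the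
    operators for y preserve the right ideal (x1, x2)B, the pair y1, y2 behaves
    in the same way on M_x.

    The third assembles the resolution of the trivial module. Left
    multiplications by y1 and y2 lift to anticommuting endomorphisms of the
    Koszul complex of x1, x2, and a diagram chase shows that the resulting total
    complex, of ranks 1, 4, 6, 4, 1, is exact ([tot_exact1], [tot_exact2],
    [tot_exact3]). *)

(** * Homogeneous matrices over a graded ring *)

(** The grading of a ring, presented by the projections [comp j] on the
    homogeneous components. *)
Record grading (R : nzRingType) (homog : int -> R -> Prop)
    (comp : int -> R -> R) : Prop := Grading {
  compD : forall j, {morph comp j : a b / a + b};
  comp_homog : forall j r, homog j (comp j r);
  comp_id : forall i j r, homog j r -> comp i r = if i == j then r else 0;
  comp_sum : forall r, exists2 s : seq int, uniq s & r = \sum_(j <- s) comp j r;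
  compMl : forall j e a b, homog e a -> comp j (a * b) = a * comp (j - e) b
}.

Section GradedMatrices.
Variables (R : nzRingType) (homog : int -> R -> Prop) (comp : int -> R -> R).
Hypothesis gr : grading homog comp.

(** The matrices of the degree-preserving maps between graded free modules
    whose basis vectors have the degrees given by q and by p. *)
Definition mx_homog m n (p : 'I_m -> int) (q : 'I_n -> int) (A : 'M[R]_(m, n)) :=
  forall a b, homog (q b - p a) (A a b).

Definition mx_comp m n (p : 'I_m -> int) (q : 'I_n -> int) (A : 'M[R]_(m, n)) :=
  \matrix_(a, b) comp (q b - p a) (A a b).

Lemma comp0 j : comp j 0 = 0.
Proof. by apply: (addrI (comp j 0)); rewrite -(compD gr) !addr0. Qed.

Lemma compB j : {morph comp j : a b / a - b}.
Proof.
by move=> a b; apply: (addIr (comp j b)); rewrite -(compD gr) !subrK.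
Qed.

Lemma comp_homogE j r : homog j r <-> comp j r = r.
Proof.
split=> [/(comp_id gr) ->|<-]; rewrite ?eqxx //.
exact: comp_homog gr _ _.
Qed.

(** That 1 has degree zero is automatic: by [compMl], right multiplication by
    its component of degree zero fixes every homogeneous element. *)
Lemma comp1 : comp 0 1 = 1.
Proof.
suff fixed r : r * comp 0 1 = r by rewrite -[LHS]mul1r.
have [s _ ->] := comp_sum gr r; rewrite mulr_suml; apply: eq_bigr => j _.
have jh := comp_homog gr j r.
by rewrite -(subrr j) -(compMl gr _ _ jh) mulr1; apply/comp_homogE.
Qed.

Lemma mx_homog1 m (p : 'I_m -> int) : mx_homog p p 1%:M.
Proof.
move=> a b; apply/comp_homogE; rewrite mxE.
by case: eqVneq => [->|_]; rewrite ?subrr ?comp1 ?comp0.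
Qed.

Section Fixed.
Variables (m n : nat) (p : 'I_m -> int) (q : 'I_n -> int).

Lemma mx_comp_homog A : mx_homog p q (mx_comp p q A).
Proof. by move=> a b; rewrite mxE; apply: comp_homog gr _ _. Qed.

Lemma mx_homogE A : mx_homog p q A <-> mx_comp p q A = A.
Proof.
split=> [Ah|<-]; last exact: mx_comp_homog.
by apply/matrixP => a b; rewrite mxE; apply/comp_homogE.
Qed.

Lemma mx_homogB A B :
  mx_homog p q A -> mx_homog p q B -> mx_homog p q (A - B).
Proof.
move=> /mx_homogE Ah /mx_homogE Bh; apply/mx_homogE/matrixP => a b.
by rewrite !mxE compB -{2}Ah -{2}Bh !mxE.
Qed.

End Fixed.

Lemma mx_compM m n k (p : 'I_m -> int) (q : 'I_n -> int) (r : 'I_k -> int) A B :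
  mx_homog p q A -> mx_comp p r (A *m B) = A *m mx_comp q r B.
Proof.
move=> Ah; apply/matrixP => a c; rewrite !mxE.
rewrite (big_morph _ (compD gr _) (comp0 _)); apply: eq_bigr => b _.
rewrite mxE (compMl gr _ _ (Ah a b)); congr (_ * comp _ _).
by rewrite opprB addrA subrK.
Qed.

Lemma mx_homogM m n k (p : 'I_m -> int) (q : 'I_n -> int) (r : 'I_k -> int) A B :
  mx_homog p q A -> mx_homog q r B -> mx_homog p r (A *m B).
Proof.
by move=> Ah /mx_homogE Bh; apply/mx_homogE; rewrite (mx_compM _ _ Ah) Bh.
Qed.

(** A solution of a graded linear system with homogeneous right-hand side may
    be taken homogeneous: discard the components in the wrong degrees. *)
Lemma mx_lift m n k (p : 'I_m -> int) (q : 'I_n -> int) (r : 'I_k -> int)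
    (D : 'M[R]_(m, n)) (A : 'M[R]_(m, k)) :
  mx_homog p q D -> mx_homog p r A ->
  (forall c, exists w, col c A = D *m w) ->
  exists2 W, mx_homog q r W & A = D *m W.
Proof.
move=> Dh Ah /choice [w wP].
exists (mx_comp q r (\matrix_(b, c) w c b 0)); first exact: mx_comp_homog.
rewrite -(mx_compM _ _ Dh) -{1}((mx_homogE p r A).1 Ah); congr mx_comp.
apply/matrixP => a c; have /matrixP/(_ a 0) := wP c; rewrite !mxE => ->.
by apply: eq_bigr => b _; rewrite mxE.
Qed.

End GradedMatrices.

(** * Comparison of graded free resolutions *)

Section Comparison.
Variables (K : fieldType) (R : nzRingType) (homog : int -> R -> Prop).
Variables (eps : {rmorphism R -> K}) (comp : int -> R -> R).
Hypothesis gr : grading homog comp.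
Hypothesis eps_homog : forall j r, homog j r -> j != 0 -> eps r = 0.

Section OneResolution.
Variables (M : gmodule homog) (F : free_resolution M).

Definition augmap (v : 'cV[R]_(grank F 0)) : M :=
  \sum_a (v a 0 : R^c) *: aug a.

Lemma augmap_mul m (A : 'M[R]_(grank F 0, m)) (v : 'cV[R]_m) :
  augmap (A *m v) = \sum_b (v b 0 : R^c) *: augmap (col b A).
Proof.
rewrite /augmap; under eq_bigr do rewrite mxE scaler_suml.
rewrite exchange_big; apply: eq_bigr => b _; rewrite scaler_sumr.
by apply: eq_bigr => a _; rewrite scalerA mxE.
Qed.

Lemma augmapB u v : augmap (u - v) = augmap u - augmap v.
Proof.
by rewrite /augmap -sumrB; apply: eq_bigr => a _; rewrite !mxE scalerBl.
Qed.

(** The augmentation serves as the differential out of degree zero, which lets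
    the two exactness conditions of a resolution be used uniformly. *)
Definition is_cycle i : 'cV[R]_(grank F i) -> Prop :=
  match i return 'cV[R]_(grank F i) -> Prop with
  | 0 => fun v => augmap v = 0
  | i'.+1 => fun v => diff F i' *m v = 0
  end.

Lemma is_cycleP i v : is_cycle v <-> exists w, v = diff F i *m w.
Proof. by case: i v => [|i] v; [apply: exact_aug | apply: exact_diff]. Qed.

Lemma is_cycle_diff i w : is_cycle (diff F i *m w).
Proof. by apply/is_cycleP; exists w. Qed.

Lemma diff_diff i : diff F i *m diff F i.+1 = 0.
Proof.
apply/matrixP => a b.
have := is_cycle_diff (delta_mx b (0 : 'I_1) : 'cV_(grank F i.+2)).
by move=> /= /matrixP/(_ a 0); rewrite mulmxA -colE !mxE.
Qed.

Lemma diff_mx_homog i :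
  mx_homog homog (@gdeg _ _ _ F i) (@gdeg _ _ _ F i.+1) (diff F i).
Proof. exact: diff_homog. Qed.

(** Components of the coefficients of an arbitrary preimage give a homogeneous
    one, because M is the direct sum of its graded parts. *)
Lemma aug_homog_lift e m : gpart e m ->
  exists2 v : 'cV[R]_(grank F 0),
    forall a, homog (e - gdeg a) (v a 0) & m = augmap v.
Proof.
move=> me; have [v mE] := aug_surj F m.
have /choice [s sP] : forall a, exists s : seq int,
    uniq s /\ v a 0 = \sum_(j <- s) comp j (v a 0).
  by move=> a; have [s] := comp_sum gr (v a 0); exists s.
(* All the degrees that occur in m, together with e, which need not occur. *)
pose S := undup
  (e :: flatten [seq [seq j + gdeg a | j <- s a] | a <- enum 'I_(grank F 0)]).
pose w k : 'cV[R]_(grank F 0) := \col_a comp (k - gdeg a) (v a 0).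
have vE a : v a 0 = \sum_(k <- S) w k a 0.
  have [us vaE] := sP a; rewrite {1}vaE.
  under [RHS]eq_bigr do rewrite mxE.
  have -> : \sum_(j <- s a) comp j (v a 0) =
      \sum_(k <- [seq j + gdeg a | j <- s a]) comp (k - gdeg a) (v a 0).
    by rewrite big_map; apply: eq_bigr => j _; rewrite addrK.
  pose sa := [seq j + gdeg a | j <- s a]; have usa : uniq sa.
    by rewrite map_inj_uniq //; apply: addIr.
  rewrite -[RHS](big_rmcond_in _ (P := fun k => k \in sa)) /=; last first.
    move=> k _ kN; rewrite vaE (big_morph _ (compD gr _) (comp0 gr _)).
    rewrite big1_seq // => j /= js.
    rewrite (comp_id gr _ (comp_homog gr _ _)); case: eqP => // kj.
    by case/negP: kN; apply/mapP; exists j => //; rewrite -kj subrK.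
  rewrite -[RHS]big_filter; apply: perm_big; apply: uniq_perm => //.
    by rewrite filter_uniq // undup_uniq.
  move=> k; rewrite mem_filter; case: (boolP (k \in _)) => //= ks.
  rewrite mem_undup in_cons; apply/esym/orP; right; apply/flatten_mapP.
  by exists a; rewrite ?mem_enum.
have wk k : gpart k (augmap (w k)).
  rewrite /augmap; elim/big_ind: _ => [|x y xk yk|a _]; first exact: gpart0.
    rewrite -[y]opprK; apply: gpartB => //; rewrite -[- y]sub0r.
    by apply: gpartB => //; apply: gpart0.
  rewrite -{1}[k](addrNK (gdeg a)) addrC; apply: gpart_act (aug_homog _) _.
  by rewrite mxE; apply: comp_homog gr _ _.
have mS : m = \sum_(k <- S) augmap (w k).
  rewrite mE /augmap exchange_big; apply: eq_bigr => a _.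
  by rewrite vE scaler_suml.
have := @gpart_direct _ _ M S (fun k => augmap (w k) - (if k == e then m else 0)).
move=> /(_ (undup_uniq _)) dir; exists (w e).
  by move=> a; rewrite mxE; apply: comp_homog gr _ _.
have eS : e \in S by rewrite mem_undup mem_head.
have {dir} := dir _ _ e eS; rewrite eqxx => dir; apply/esym/eqP; rewrite -subr_eq0.
apply/eqP; apply: dir.
  by move=> k; case: eqP => [->|_]; apply: gpartB => //; apply: gpart0.
rewrite sumrB -mS (bigD1_seq e) ?undup_uniq //= eqxx big1 ?addr0 ?subrr //.
by move=> k /negPf ->.
Qed.

End OneResolution.

Section ChainMaps.
Variables (M : gmodule homog).

Definition chain_map (F G : free_resolution M)
    (f : forall i, 'M[R]_(grank G i, grank F i)) :=
  [/\ forall i, mx_homog homog (@gdeg _ _ _ G i) (@gdeg _ _ _ F i) (f i),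
      forall v, augmap (f 0 *m v) = augmap v
    & forall i, diff G i *m f i.+1 = f i *m diff F i].

(** The comparison map is built one degree at a time; that it sends cycles to
    cycles is what allows the next step, and follows from it in turn. *)
Lemma chain_map_exists (F G : free_resolution M) : exists f, @chain_map F G f.
Proof.
pose good i (f : 'M[R]_(grank G i, grank F i)) :=
  mx_homog homog (@gdeg _ _ _ G i) (@gdeg _ _ _ F i) f /\
  forall v : 'cV_(grank F i), is_cycle v -> is_cycle (f *m v).
have step i f : good i f ->
    {f' | good i.+1 f' & diff G i *m f' = f *m diff F i}.
  move=> [fh fc]; apply: cid2.
  have cyc c : exists w, col c (f *m diff F i) = diff G i *m w.
    by apply/is_cycleP; rewrite colE -mulmxA; apply/fc/is_cycle_diff.
  have [f' f'h E] := mx_lift gr (@diff_mx_homog _ G i)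
    (mx_homogM gr fh (@diff_mx_homog _ F i)) cyc.
  exists f'; last by [].
  by split=> // v /= dv; rewrite mulmxA -E -mulmxA dv mulmx0.
have [f0 f0g f0a] : {f0 | good 0 f0 & forall v, augmap (f0 *m v) = augmap v}.
  apply: cid2.
  have /choice [w wP] : forall b : 'I_(grank F 0), exists v : 'cV_(grank G 0),
      (forall a, homog (gdeg b - gdeg a) (v a 0)) /\ aug b = augmap v.
    by move=> b; have [v] := aug_homog_lift G (aug_homog b); exists v.
  pose f0 : 'M_(grank G 0, grank F 0) := \matrix_(a, b) w b a 0.
  have f0a v : augmap (f0 *m v) = augmap v.
    rewrite augmap_mul; apply: eq_bigr => b _; rewrite (wP b).2.
    by congr (_ *: augmap _); apply/matrixP => a c; rewrite !mxE ord1.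
  exists f0 => //; split=> [a b|v /= <- //]; first by rewrite mxE; apply: (wP b).1.
pose f := nat_rect (fun i => {f | good i f}) (exist _ f0 f0g)
  (fun i g => let f' := step i _ (proj2_sig g) in
              exist _ (s2val f') (s2valP f')).
exists (fun i => proj1_sig (f i)); split=> [i||i].
- exact: (proj2_sig (f i)).1.
- exact: f0a.
exact: (s2valP' (step i _ (proj2_sig (f i)))).
Qed.

(** The shape of the second term of a homotopy formula f = d h + h' d, which is
    absent in degree zero. *)
Definition factors_diff (F : free_resolution M) i :
    'M[R]_(grank F i) -> Prop :=
  match i return 'M[R]_(grank F i) -> Prop with
  | 0 => fun c => c = 0
  | i'.+1 => fun c => exists h : 'M_(grank F i'.+1, grank F i'),
      c = h *m diff F i'
  end.

Lemma factors_diffM (F : free_resolution M) i (c : 'M[R]_(grank F i)) :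
  factors_diff c -> c *m diff F i = 0.
Proof.
case: i c => [|i] c /=; first by move=> ->; rewrite mul0mx.
by case=> h ->; rewrite -mulmxA diff_diff mulmx0.
Qed.

(** A chain map covering zero on M is null-homotopic. Homology in degree i sees
    only the part of the homotopy around that degree, so it is enough to state
    its existence separately for each i. *)
Lemma homotopy_exists (F : free_resolution M)
    (f : forall i, 'M[R]_(grank F i)) :
    (forall i, mx_homog homog (@gdeg _ _ _ F i) (@gdeg _ _ _ F i) (f i)) ->
    (forall v, augmap (f 0 *m v) = 0) ->
    (forall i, diff F i *m f i.+1 = f i *m diff F i) ->
  forall i, exists2 h : 'M[R]_(grank F i.+1, grank F i),
    mx_homog homog (@gdeg _ _ _ F i.+1) (@gdeg _ _ _ F i) h
    & factors_diff (f i - diff F i *m h).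
Proof.
move=> fh f0 fd; elim=> [|i [h hh hc]].
  have cyc b : exists w, col b (f 0) = diff F 0 *m w.
    by apply/is_cycleP; rewrite /= colE; apply: f0.
  have [h hh E] := mx_lift gr (@diff_mx_homog _ F 0) (fh 0) cyc.
  by exists h => //; rewrite /= E subrr.
have gh : mx_homog homog (@gdeg _ _ _ F i.+1) (@gdeg _ _ _ F i.+1)
    (f i.+1 - h *m diff F i).
  by apply: (mx_homogB gr) => //; apply: (mx_homogM gr hh (@diff_mx_homog _ F i)).
have cyc b : exists w, col b (f i.+1 - h *m diff F i) = diff F i.+1 *m w.
  apply/is_cycleP; rewrite /= colE mulmxA mulmxBr fd mulmxA -mulmxBl.
  by rewrite factors_diffM // mul0mx.
have [h' h'h E] := mx_lift gr (@diff_mx_homog _ F i.+1) gh cyc.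
by exists h' => //; exists h; rewrite -E opprB addrCA subrr addr0.
Qed.

End ChainMaps.

Section TensorDim.
Variables (M : gmodule homog).

Lemma tensor_partP (F : free_resolution M) i j (v : 'cV[K]_(grank F i)) :
  reflect (forall a : 'I_(grank F i), gdeg a != j -> v a 0 = 0)
          (v \in tensor_part K F i j).
Proof.
apply: (iffP idP) => [vj a aj|v0].
  pose g := linfun (mulmx (delta_mx (0 : 'I_1) a : 'rV[K]_(grank F i)))
    : 'Hom('cV[K]_(grank F i), 'M[K]_1).
  have /subvP/(_ _ vj) : (tensor_part K F i j <= lker g)%VS.
    apply/span_subvP => _ /mapP[b + ->]; rewrite mem_filter memv_ker lfunE /=.
    case/andP=> /eqP bj _; rewrite mul_delta_mx_cond; case: (eqVneq a b) => [ab|_ //].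
    by rewrite ab bj eqxx in aj.
  rewrite memv_ker lfunE /= -rowE => /eqP/matrixP/(_ 0 0).
  by rewrite !mxE.
have -> : v = \sum_a v a 0 *: delta_mx a 0.
  by rewrite {1}[v]matrix_sum_delta; apply: eq_bigr => a _; rewrite big_ord1.
apply: rpred_sum => a _; case: (eqVneq (gdeg a) j) => [aj|/v0 ->].
  by apply/rpredZ/memv_span/mapP; exists a; rewrite // mem_filter aj eqxx mem_enum.
by rewrite scale0r mem0v.
Qed.

Lemma tensor_part_map (F G : free_resolution M) i i' j
    (f : 'M[R]_(grank G i', grank F i)) v :
    mx_homog homog (@gdeg _ _ _ G i') (@gdeg _ _ _ F i) f ->
  v \in tensor_part K F i j -> map_mx eps f *m v \in tensor_part K G i' j.
Proof.
move=> fh /tensor_partP v0; apply/tensor_partP => a aj; rewrite mxE big1 // => b _.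
case: (eqVneq (gdeg b) j) => [bj|/v0 ->]; last by rewrite mulr0.
by rewrite mxE (eps_homog (fh a b)) ?mul0r // subr_eq0 bj eq_sym.
Qed.

Lemma mem_cycles (F : free_resolution M) i j v : v \in cycles eps F i j <->
  v \in tensor_part K F i j /\
  match i return 'cV[K]_(grank F i) -> Prop with
  | 0 => fun=> True
  | i'.+1 => fun v => map_mx eps (diff F i') *m v = 0
  end v.
Proof.
case: i v => [|i] v /=; first by split=> [|[]].
rewrite memv_cap memv_ker lfunE /=.
by split=> [/andP[-> /eqP]|[-> ->]] //; rewrite eqxx.
Qed.

Lemma factors_diff_cycle (F : free_resolution M) i j (c : 'M[R]_(grank F i)) z :
  factors_diff c -> z \in cycles eps F i j -> map_mx eps c *m z = 0.
Proof.
move=> fc /mem_cycles[_]; case: i c z fc => [|i] c z /=.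
  by move=> -> _; rewrite map_mx0 mul0mx.
by case=> h -> dz; rewrite map_mxM -mulmxA dz mulmx0.
Qed.

Lemma mem_boundaries (F : free_resolution M) i j v :
  v \in boundaries eps F i j <->
  exists2 w, w \in tensor_part K F i.+1 j & v = map_mx eps (diff F i) *m w.
Proof.
split=> [/memv_imgP[w wj]|[w wj]]; first by rewrite lfunE; exists w.
by move=> ->; apply/memv_imgP; exists w; rewrite ?lfunE.
Qed.

Lemma boundaries_sub (F : free_resolution M) i j :
  (boundaries eps F i j <= cycles eps F i j)%VS.
Proof.
apply/subvP => _ /mem_boundaries[w wj ->]; apply/mem_cycles.
split; first exact: tensor_part_map (@diff_mx_homog _ F i) wj.
case: i w wj => [|i] w wj //=.
by rewrite mulmxA -map_mxM diff_diff map_mx0 mul0mx.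
Qed.

(** A map of complexes that is injective on homology does not decrease its
    dimension, homology being given by cycles Z and boundaries B. *)
Lemma homology_dim_le (U V : vectType K) (f : 'Hom(U, V))
    (Z B : {vspace U}) (Z' B' : {vspace V}) :
    (f @: Z <= Z')%VS -> (B' <= Z')%VS ->
    (forall z, z \in Z -> f z \in B' -> z \in B) ->
  (\dim Z - \dim B <= \dim Z' - \dim B')%N.
Proof.
move=> fZ BZ' fB; pose q : 'End(V) := (\1 - projv B')%VF.
have qE v : (q v == 0) = (v \in B').
  rewrite add_lfunE opp_lfunE id_lfunE subr_eq0; apply/eqP/idP => [->|/projv_id //].
  exact: memv_proj.
(* q has kernel B', so q o f has kernel inside B on Z. *)
have kerZ : (\dim (Z :&: lker (q \o f)) <= \dim B)%N.
  apply/dimvS/subvP => z; rewrite memv_cap memv_ker comp_lfunE qE.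
  by case/andP=> zZ; apply: fB.
have kerZ' : (\dim B' <= \dim (Z' :&: lker q))%N.
  apply/dimvS; rewrite subv_cap BZ' /=; apply/subvP => v.
  by rewrite memv_ker qE.
have img : (\dim ((q \o f) @: Z) <= \dim (q @: Z'))%N.
  by rewrite limg_comp; apply/dimvS/limgS.
rewrite -(limg_ker_dim (q \o f) Z) -(limg_ker_dim q Z').
rewrite leq_subLR (leq_trans (leq_add kerZ img)) // leq_add2l.
by rewrite addnC -addnBA // leq_addr.
Qed.

(** With f : F -> G and g : G -> F the comparison maps, 1 - g f is
    null-homotopic, so f is injective on the homology of the tensor product. *)
Lemma tor_dim_le (F G : free_resolution M) i j :
  (tor_dim eps F i j <= tor_dim eps G i j)%N.
Proof.
have [f [fh fa fd]] := chain_map_exists F G.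
have [g [gh ga gd]] := chain_map_exists G F.
pose r k : 'M[R]_(grank F k) := 1%:M - g k *m f k.
have rh k : mx_homog homog (@gdeg _ _ _ F k) (@gdeg _ _ _ F k) (r k).
  exact: (mx_homogB gr (mx_homog1 gr _) (mx_homogM gr (gh k) (fh k))).
have ra v : augmap (r 0 *m v) = 0.
  by rewrite mulmxBl mul1mx augmapB -mulmxA ga fa subrr.
have rd k : diff F k *m r k.+1 = r k *m diff F k.
  by rewrite mulmxBr mulmx1 mulmxA gd -mulmxA fd mulmxA mulmxBl mul1mx.
have [h hh hc] := homotopy_exists rh ra rd i.
rewrite /tor_dim; pose u := linfun (mulmx (map_mx eps (f i)))
  : 'Hom('cV[K]_(grank F i), 'cV[K]_(grank G i)).
apply: (@homology_dim_le _ _ u) (boundaries_sub G i j) _.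
  apply/subvP => _ /memv_imgP[z /mem_cycles[zj dz] ->]; rewrite lfunE /=.
  apply/mem_cycles; split; first exact: tensor_part_map.
  case: (i) z zj dz => [|k] z zj dz //.
  by rewrite mulmxA -map_mxM fd map_mxM -mulmxA dz mulmx0.
move=> z zZ /mem_boundaries[w wj]; rewrite lfunE /= => fz.
have [zj _] := (mem_cycles _ _).1 zZ.
apply/mem_boundaries.
exists (map_mx eps h *m z + map_mx eps (g i.+1) *m w).
  by apply: rpredD; apply: tensor_part_map.
(* z = (1 - gf)z + gfz = d h z + g d w = d (h z + g w) in the tensor product *)
rewrite mulmxDr !mulmxA -!map_mxM gd (map_mxM _ (g i)) -(mulmxA _ _ w) -fz.
rewrite mulmxA -map_mxM.
have cz := factors_diff_cycle hc zZ.
rewrite -[LHS](subrK (map_mx eps (g i *m f i) *m z)); congr (_ + _).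
rewrite -{1}[z]mul1mx -(map_mx1 eps) -mulmxBl -map_mxB -/(r i).
by rewrite -[r i](subrK (diff F i *m h)) map_mxD mulmxDl cz add0r.
Qed.

Lemma tor_dim_indep (F G : free_resolution M) i j :
  tor_dim eps F i j = tor_dim eps G i j.
Proof. by apply/eqP; rewrite eqn_leq !tor_dim_le. Qed.

Lemma bettiE (F : free_resolution M) i j : betti eps M i j = tor_dim eps F i j.
Proof.
rewrite /betti; case: pselect => [ex|[]]; last by exists (tor_dim eps F i j), F.
by case: (cid ex) => n /= [G <-]; apply: tor_dim_indep.
Qed.

(** All the entries of the differentials of a linear resolution have degree
    one, hence die under eps: the resolution is minimal. *)
Lemma betti_linear (F : free_resolution M) i j :
    (forall i (a : 'I_(grank F i)), gdeg a = i%:Z) ->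
  betti eps M i j = if j == i%:Z then grank F i else 0%N.
Proof.
move=> lin; rewrite (bettiE F) /tor_dim.
have eps0 k : map_mx eps (diff F k) = 0.
  apply/matrixP => a b; rewrite !mxE; apply: (eps_homog (diff_homog a b)).
  by rewrite !lin intS addrK.
have -> : boundaries eps F i j = 0%VS.
  apply/eqP; rewrite -subv0; apply/subvP => v /mem_boundaries[w _ ->].
  by rewrite eps0 mul0mx mem0v.
have -> : cycles eps F i j = if j == i%:Z then fullv else 0%VS.
  apply/vspaceP => v; apply/idP/idP => [/mem_cycles[/tensor_partP vj _]|].
    case: eqVneq => [_|ij]; first exact: memvf.
    rewrite memv0; apply/eqP/matrixP => a b.
    by rewrite ord1 mxE vj // lin eq_sym.
  case: eqVneq => [ij _|_]; last by rewrite memv0 => /eqP ->; apply: mem0v.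
  apply/mem_cycles; split; first by apply/tensor_partP => a; rewrite lin ij eqxx.
  by case: (i) v => [|k] v //; rewrite eps0 mul0mx.
rewrite dimv0 subn0; case: ifP => _; last by rewrite dimv0.
by rewrite dimvf; apply: muln1.
Qed.

End TensorDim.

End Comparison.

(** * Left modules over B *)

Section Words.
Variables (K : fieldType) (V : lmodType K) (op : 'I_4 -> V -> V).
Hypothesis op_linear : forall i, linear (op i).

Definition word_act (w : {fmonom 'I_4}) (v : V) : V := foldr op v w.

Definition free_act (v : V) (f : free4 K) : V :=
  \sum_(w <- msupp f) f@_w *: word_act w v.

Lemma word_act_linear w : linear (word_act w).
Proof.
move=> c u v; rewrite /word_act; elim: (w : seq _) => //= i s ->.
exact: op_linear.
Qed.

HB.instance Definition _ w :=
  GRing.isLinear.Build K V V *:%R (word_act w) (word_act_linear w).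

Lemma free_actEw (d : {fset {fmonom 'I_4}}) v f : (msupp f `<=` d)%fset ->
  free_act v f = \sum_(w <- d) f@_w *: word_act w v.
Proof.
move=> le; rewrite [LHS](big_fset_incl _ le) //= => w _ /mcoeff_outdom ->.
by rewrite scale0r.
Qed.

Lemma free_act_linear v : linear (free_act v).
Proof.
move=> c f g; pose d := (msupp f `|` msupp g `|` msupp (c *: f + g))%fset.
rewrite !(@free_actEw d) ?/d ?fsubsetUr //.
- rewrite scaler_sumr -big_split; apply: eq_bigr => w _ /=.
  by rewrite scalerA -scalerDl mcoeffD mcoeffZ.
- by rewrite -fsetUA fsetUCA fsubsetUl.
by rewrite -fsetUA fsubsetUl.
Qed.

HB.instance Definition _ v :=
  GRing.isLinear.Build K (free4 K) V *:%R (free_act v) (free_act_linear v).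

Lemma free_actU v c w : free_act v << c *g w >> = c *: word_act w v.
Proof. by rewrite (free_actEw _ msuppU_le) big_seq_fset1 mcoeffUU. Qed.

Lemma free_actM v f g : free_act v (f * g) = free_act (free_act v g) f.
Proof.
rewrite malgME linear_sum; apply: eq_bigr => u _ /=.
rewrite linear_sum [in RHS]/free_act linear_sum scaler_sumr; apply: eq_bigr => w _ /=.
by rewrite free_actU linearZ scalerA /word_act fmM foldr_cat.
Qed.

Lemma free_act0 f : free_act 0 f = 0.
Proof. by rewrite /free_act big1 // => w _; rewrite linear0 scaler0. Qed.

Lemma free_actB v f g : free_act v (f - g) = free_act v f - free_act v g.
Proof. exact: linearB. Qed.

Lemma free_actN v f : free_act v (- f) = - free_act v f.
Proof. exact: linearN. Qed.

Lemma free_actZ v c f : free_act v (c *: f) = c *: free_act v f.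
Proof. exact: linearZ. Qed.

End Words.

(** The relations of B, together with the two facts that make them a
    presentation: the generators generate, and any left module over the free
    algebra that satisfies the relations is a B-module, whence the map
    b |-> b.v0 from B to it. The arguments about B start from this record
    rather than from the quotient of the free algebra: conversion then never
    unfolds the elements of B. *)
Record presented (K : fieldType) (alpha : K) (B : algType K) (x1 x2 y1 y2 : B)
    : Prop := Presented {
  rel_x2x1 : x2 * x1 = - (x1 * x2);
  rel_y2y1 : y2 * y1 = - (y1 * y2);
  rel_y1x1 : y1 * x1 = x1 * y1;
  rel_y1x2 : y1 * x2 = x2 * y2;
  rel_y2x1 : y2 * x1 = x1 * y2;
  rel_y2x2 : y2 * x2 = alpha *: (x2 * y1);
  generators_ind : forall P : B -> Prop,
    P 1 -> (forall c a b, P a -> P b -> P (c *: a + b)) ->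
    (forall b, P b -> [/\ P (x1 * b), P (x2 * b), P (y1 * b) & P (y2 * b)]) ->
    forall b, P b;
  module_lift : forall (V : lmodType K) (ox1 ox2 oy1 oy2 : V -> V) (v0 : V),
    linear ox1 -> linear ox2 -> linear oy1 -> linear oy2 ->
    (forall v, ox2 (ox1 v) = - ox1 (ox2 v)) ->
    (forall v, oy2 (oy1 v) = - oy1 (oy2 v)) ->
    (forall v, oy1 (ox1 v) = ox1 (oy1 v)) ->
    (forall v, oy1 (ox2 v) = ox2 (oy2 v)) ->
    (forall v, oy2 (ox1 v) = ox1 (oy2 v)) ->
    (forall v, oy2 (ox2 v) = alpha *: ox2 (oy1 v)) ->
    exists Phi : B -> V, [/\ linear Phi, Phi 1 = v0 &
      forall b, [/\ Phi (x1 * b) = ox1 (Phi b), Phi (x2 * b) = ox2 (Phi b),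
                    Phi (y1 * b) = oy1 (Phi b) & Phi (y2 * b) = oy2 (Phi b)]]
}.

Section LeftModules.
Variables (K : fieldType) (alpha : K).
Local Notation B := (BK alpha).
Local Notation X1 := (BK_x1 alpha).
Local Notation X2 := (BK_x2 alpha).
Local Notation Y1 := (BK_y1 alpha).
Local Notation Y2 := (BK_y2 alpha).
Local Notation i1 := (@Ordinal 4 0 isT).
Local Notation i2 := (@Ordinal 4 1 isT).
Local Notation i3 := (@Ordinal 4 2 isT).
Local Notation i4 := (@Ordinal 4 3 isT).

Lemma BK_piZ (c : K) f : BK_pi alpha (c *: f) = c *: BK_pi alpha f.
Proof. by rewrite /GRing.scale /= BK_scaleE. Qed.

Lemma BK_piN f : BK_pi alpha (- f) = - BK_pi alpha f.
Proof. by rewrite -[- f]sub0r BK_piB BK_pi0 sub0r. Qed.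

Lemma BK_rel f g : f - g \in BK_rels alpha -> BK_pi alpha f = BK_pi alpha g.
Proof. by move=> fr; apply/BK_piP/gen_idealP => J _; apply. Qed.

Lemma BK_rel_mem k : (k < 6)%N -> nth 0 (BK_rels alpha) k \in BK_rels alpha.
Proof. by move=> k6; apply: (@mem_nth _ 0 (BK_rels alpha)). Qed.

(* The relations are proved by transitivity rather than by rewriting: matching
   a product of letters against a different one would unfold the product of the
   free algebra. *)
Let lM (i j : 'I_4) := BK_piM alpha (letter K i) (letter K j).

Lemma x2x1 : X2 * X1 = - (X1 * X2).
Proof.
exact: (etrans (esym (lM i2 i1))
  (etrans (BK_rel (@BK_rel_mem 0 isT))
    (etrans (BK_piN _) (congr1 -%R (lM i1 i2))))).
Qed.

Lemma y2y1 : Y2 * Y1 = - (Y1 * Y2).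
Proof.
exact: (etrans (esym (lM i4 i3))
  (etrans (BK_rel (@BK_rel_mem 1 isT))
    (etrans (BK_piN _) (congr1 -%R (lM i3 i4))))).
Qed.

Lemma y1x1 : Y1 * X1 = X1 * Y1.
Proof.
exact: (etrans (esym (lM i3 i1))
  (etrans (BK_rel (@BK_rel_mem 2 isT)) (lM i1 i3))).
Qed.

Lemma y1x2 : Y1 * X2 = X2 * Y2.
Proof.
exact: (etrans (esym (lM i3 i2))
  (etrans (BK_rel (@BK_rel_mem 3 isT)) (lM i2 i4))).
Qed.

Lemma y2x1 : Y2 * X1 = X1 * Y2.
Proof.
exact: (etrans (esym (lM i4 i1))
  (etrans (BK_rel (@BK_rel_mem 4 isT)) (lM i1 i4))).
Qed.

Lemma y2x2 : Y2 * X2 = alpha *: (X2 * Y1).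
Proof.
exact: (etrans (esym (lM i4 i2))
  (etrans (BK_rel (@BK_rel_mem 5 isT))
    (etrans (BK_piZ _ _) (congr1 ( *:%R alpha) (lM i2 i3))))).
Qed.

Lemma BK_ind (P : B -> Prop) :
    P 1 -> (forall c a b, P a -> P b -> P (c *: a + b)) ->
    (forall b, P b -> [/\ P (X1 * b), P (X2 * b), P (Y1 * b) & P (Y2 * b)]) ->
  forall b, P b.
Proof.
move=> P1 Plin Pgen b; rewrite -[b]BK_piK.
have P0 : P 0 by rewrite -[0](subrr 1) addrC -scaleN1r; apply: Plin.
have Pletter i a : P a -> P (BK_pi alpha (letter K i) * a).
  case/Pgen; case: i => [[|[|[|[|i]]]] ilt] p1 p2 p3 p4; last by exfalso.
  - by rewrite (_ : Ordinal ilt = i1); [exact: p1 | apply: val_inj].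
  - by rewrite (_ : Ordinal ilt = i2); [exact: p2 | apply: val_inj].
  - by rewrite (_ : Ordinal ilt = i3); [exact: p3 | apply: val_inj].
  - by rewrite (_ : Ordinal ilt = i4); [exact: p4 | apply: val_inj].
have Pword (w : {fmonom 'I_4}) : P (BK_pi alpha << w >>).
  case: w => s; elim: s => [|i s IHs]; first by rewrite -fmoneE.
  have -> : << FMonom (i :: s) >> = letter K i * << FMonom s >> :> free4 K.
    rewrite malgM_def fgmulUU mulr1; congr (<< _ >>).
    by apply/val_inj; rewrite /= fmM fmU.
  by rewrite BK_piM; apply: Pletter.
rewrite [repr b]monalgE; elim/big_ind: _ => [|f g Pf Pg|w _].
- by rewrite BK_pi0.
- by rewrite BK_piD -[BK_pi _ f]scale1r; apply: Plin.
have -> : << (repr b)@_w *g w >> = (repr b)@_w *: << w >> :> free4 K.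
  by apply/malgP => u; rewrite mcoeffZ !mcoeffU mulr_natr.
by rewrite BK_piZ -[_ *: _]addr0; apply: Plin.
Qed.

(** The elements of the free algebra that kill V form a two-sided ideal, which
    contains the relations. *)
Lemma BK_module_lift (V : lmodType K) (ox1 ox2 oy1 oy2 : V -> V) (v0 : V) :
    linear ox1 -> linear ox2 -> linear oy1 -> linear oy2 ->
    (forall v, ox2 (ox1 v) = - ox1 (ox2 v)) ->
    (forall v, oy2 (oy1 v) = - oy1 (oy2 v)) ->
    (forall v, oy1 (ox1 v) = ox1 (oy1 v)) ->
    (forall v, oy1 (ox2 v) = ox2 (oy2 v)) ->
    (forall v, oy2 (ox1 v) = ox1 (oy2 v)) ->
    (forall v, oy2 (ox2 v) = alpha *: ox2 (oy1 v)) ->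
  exists Phi : B -> V, [/\ linear Phi, Phi 1 = v0 &
    forall b, [/\ Phi (X1 * b) = ox1 (Phi b), Phi (X2 * b) = ox2 (Phi b),
                  Phi (Y1 * b) = oy1 (Phi b) & Phi (Y2 * b) = oy2 (Phi b)]].
Proof.
move=> lx1 lx2 ly1 ly2 r1 r2 r3 r4 r5 r6.
pose op (i : 'I_4) := nth ox1 [:: ox1; ox2; oy1; oy2] i.
have opl i : linear (op i) by case: i => [[|[|[|[|]]]]].
have act_letter v i : free_act op v (letter K i) = op i v.
  by rewrite free_actU scale1r /word_act fmU.
have kill f : f \in BK_ideal alpha -> forall v, free_act op v f = 0.
  move=> /gen_idealP/(_ (fun f => forall v, free_act op v f = 0)); apply.
    split=> [v|a b a0 b0 v|a b c b0 v]; first by rewrite -(subrr 0) free_actB subrr.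
      by rewrite free_actB a0 b0 subrr.
    by rewrite !(free_actM opl) b0 (free_act0 opl).
  have killB g h : (forall v, free_act op v g = free_act op v h) ->
      forall v, free_act op v (g - h) = 0.
    by move=> gh v; rewrite free_actB gh subrr.
  pose aM v i j := etrans (free_actM opl v (letter K i) (letter K j))
    (etrans (act_letter _ i) (congr1 (op i) (act_letter v j))).
  rewrite /BK_rels => {}f.
  rewrite in_cons => /predU1P[->|].
    apply: killB => v; apply: etrans (aM v i2 i1) (etrans (r1 v) _).
    by rewrite free_actN; apply/esym/(congr1 -%R (aM v i1 i2)).
  rewrite in_cons => /predU1P[->|].
    apply: killB => v; apply: etrans (aM v i4 i3) (etrans (r2 v) _).
    by rewrite free_actN; apply/esym/(congr1 -%R (aM v i3 i4)).
  rewrite in_cons => /predU1P[->|].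
    apply: killB => v.
    exact: etrans (aM v i3 i1) (etrans (r3 v) (esym (aM v i1 i3))).
  rewrite in_cons => /predU1P[->|].
    apply: killB => v.
    exact: etrans (aM v i3 i2) (etrans (r4 v) (esym (aM v i2 i4))).
  rewrite in_cons => /predU1P[->|].
    apply: killB => v.
    exact: etrans (aM v i4 i1) (etrans (r5 v) (esym (aM v i1 i4))).
  rewrite mem_seq1 => /eqP ->; apply: killB => v.
  apply: etrans (aM v i4 i2) (etrans (r6 v) _).
  by rewrite free_actZ; apply/esym/(congr1 ( *:%R alpha) (aM v i2 i3)).
have wd f g : BK_pi alpha f = BK_pi alpha g -> free_act op v0 f = free_act op v0 g.
  by move/BK_piP/kill => /(_ v0); rewrite free_actB => /eqP; rewrite subr_eq0 => /eqP.
have Phi_gen i b : free_act op v0 (repr (BK_pi alpha (letter K i) * b)) =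
    op i (free_act op v0 (repr b)).
  by rewrite -act_letter -(free_actM opl); apply: wd; rewrite BK_piM !BK_piK.
exists (fun b => free_act op v0 (repr b)); split=> [c a b||b].
- rewrite -free_act_linear.
  have E : BK_pi alpha (repr (c *: a + b)) = BK_pi alpha (c *: repr a + repr b).
    by rewrite BK_piD BK_piZ !BK_piK.
  exact: wd E.
- have E : BK_pi alpha (repr (1 : B)) = BK_pi alpha 1 by rewrite BK_piK.
  by rewrite (wd _ _ E) free_actU scale1r /word_act fm1.
by split; apply: Phi_gen.
Qed.

Lemma BK_presented : presented alpha X1 X2 Y1 Y2.
Proof.
exact: Presented x2x1 y2y1 y1x1 y1x2 y2x1 y2x2 BK_ind BK_module_lift.
Qed.

End LeftModules.

(** * Skew derivations and the pairs x1, x2 and y1, y2 *)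

(** Exactness modulo J of the Koszul complex of two anticommuting elements,
    from operators D1 and D2 that divide on the left by z1 and z2. It is used
    with J = 0, and with J the right ideal generated by the other pair. *)
Section KoszulPair.
Variables (R : nzRingType) (z1 z2 : R) (D1 D2 : R -> R) (J : R -> Prop).
Hypothesis z21 : z2 * z1 = - (z1 * z2).
Hypothesis D1D : {morph D1 : a b / a + b}.
Hypothesis D1z1 : forall b, D1 (z1 * b) = b.
Hypothesis D1z2 : forall b, D1 (z2 * b) = - (z2 * D1 b).
Hypothesis D2z2 : forall b, D2 (z2 * b) = b.
Hypothesis JB : forall a b, J a -> J b -> J (a - b).
Hypothesis Jz : forall a, J a -> J (z1 * a).
Hypothesis JD : forall a, J a -> J (D1 a) /\ J (D2 a).

Lemma skew_cancel c : J (z2 * c) -> J c.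
Proof. by case/JD => _; rewrite D2z2. Qed.

(** D1 gives a = z2 c with c = D1 b. Then z2 (b - z1 c) is zero as well, by
    anticommutation, and can be divided by z2. *)
Lemma skew_exact a b : J (z1 * a + z2 * b) ->
  exists c, J (a - z2 * c) /\ J (b - z1 * c).
Proof.
move=> Jab; exists (D1 b).
have Ja : J (a - z2 * D1 b) by have [] := JD Jab; rewrite D1D D1z1 D1z2.
split=> //; apply: skew_cancel.
have -> : z2 * (b - z1 * D1 b) = (z1 * a + z2 * b) - z1 * (a - z2 * D1 b).
  by rewrite !mulrBr !mulrA z21 mulNr opprK opprB [z1 * a + _]addrC
        addrACA subrr addr0.
exact: JB (Jz Ja).
Qed.

End KoszulPair.

Section SkewDerivations.
Variables (K : fieldType) (alpha : K) (B : algType K) (x1 x2 y1 y2 : B).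
Hypothesis alpha_neq0 : alpha != 0.
Hypothesis pres : presented alpha x1 x2 y1 y2.

Let x2x1 := rel_x2x1 pres.
Let y2y1 := rel_y2y1 pres.
Let y1x1 := rel_y1x1 pres.
Let y1x2 := rel_y1x2 pres.
Let y2x1 := rel_y2x1 pres.
Let y2x2 := rel_y2x2 pres.
Let ind := generators_ind pres.
Let universal := module_lift pres.

Let triple_ext (u v : B * B * B) :
  u.1.1 = v.1.1 -> u.1.2 = v.1.2 -> u.2 = v.2 -> u = v.
Proof. by case: u v => [[? ?] ?] [[? ?] ?] /= -> -> ->. Qed.

Let mulZr (c : K) (a b : B) : a * (c *: b) = c *: (a * b).
Proof. by rewrite scalerAr. Qed.

Let lin :=
  (@mulrDr B, mulZr, @scalerDr K B, @opprD B, @scalerN K B, @mulrN B, @opprK B).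

(** The operators on B^3 are forced by the wish that b |-> (b, D1 b, D2 b) be
    left linear: x1 and x2 normalize B, and D1, D2 commute with a generator up
    to the corresponding twist (for D2 it is y1 -> y2 -> alpha y1). *)
Lemma x_derivations : exists D1 D2 : B -> B,
  [/\ {morph D1 : a b / a + b}, {morph D2 : a b / a + b},
      forall b, D1 (x1 * b) = b, forall b, D1 (x2 * b) = - (x2 * D1 b) &
      (forall b, D2 (x1 * b) = - (x1 * D2 b)) /\ forall b, D2 (x2 * b) = b].
Proof.
pose V := (B * B * B)%type.
pose ox1 (u : V) : V := (x1 * u.1.1, u.1.1, - (x1 * u.2)).
pose ox2 (u : V) : V := (x2 * u.1.1, - (x2 * u.1.2), u.1.1).
pose oy1 (u : V) : V := (y1 * u.1.1, y1 * u.1.2, y2 * u.2).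
pose oy2 (u : V) : V := (y2 * u.1.1, y2 * u.1.2, alpha *: (y1 * u.2)).
have [||||v|v|v|v|v|v|Phi [PhiL Phi1 Phig]] :=
  @universal V ox1 ox2 oy1 oy2 (1, 0, 0).
- by move=> c u v; apply: triple_ext; rewrite /= ?lin.
- by move=> c u v; apply: triple_ext; rewrite /= ?lin.
- by move=> c u v; apply: triple_ext; rewrite /= ?lin.
- move=> c u v; apply: triple_ext; rewrite /= ?lin //.
  by rewrite !scalerA mulrC.
- by apply: triple_ext; rewrite /= ?lin ?mulrA ?x2x1 ?mulNr.
- by apply: triple_ext; rewrite /= ?mulZr ?mulrA ?y2y1 ?mulNr ?scalerN ?opprK.
- by apply: triple_ext; rewrite /= ?lin ?mulrA ?y1x1 ?y2x1.
- by apply: triple_ext; rewrite /= ?lin ?mulrA ?y1x2.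
- by apply: triple_ext; rewrite /= ?lin ?mulrA ?y2x1 ?y1x1.
- by apply: triple_ext; rewrite /= ?lin ?mulrA ?y2x2 ?scalerAl.
have PhiD a b : Phi (a + b) = Phi a + Phi b.
  by have := PhiL 1 a b; rewrite !scale1r.
have Phi11 b : (Phi b).1.1 = b.
  elim/ind: b => [|c a b IHa IHb|b IHb]; first by rewrite Phi1.
    by rewrite PhiL /= IHa IHb.
  by case: (Phig b) => -> -> -> ->; rewrite /= IHb.
exists (fun b => (Phi b).1.2), (fun b => (Phi b).2).
split=> [a b|a b|b|b|]; rewrite ?PhiD //; first 2 last.
- split=> b; case: (Phig b) => E1 E2 _ _; first by rewrite E1.
  by rewrite E2 /= Phi11.
- by case: (Phig b) => -> _ _ _ /=.
- by case: (Phig b) => _ -> _ _ /=.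
Qed.


(** Moving x2 past y1 and y2 exchanges them, so D1(x2 b) involves D2 b and
    conversely: x2 y2 = y1 x2, while x2 y1 = alpha^-1 y2 x2. This is where alpha
    has to be invertible. *)
Lemma y_derivations : exists D1 D2 : B -> B,
  [/\ {morph D1 : a b / a + b}, {morph D2 : a b / a + b},
      forall b, [/\ D1 (y1 * b) = b, D1 (y2 * b) = - (y2 * D1 b)
                  & D2 (y2 * b) = b],
      forall b, D1 (x1 * b) = x1 * D1 b /\ D1 (x2 * b) = x2 * D2 b &
      forall b, D2 (x1 * b) = x1 * D2 b /\
                D2 (x2 * b) = alpha^-1 *: (x2 * D1 b)].
Proof.
pose V := (B * B * B)%type.
pose ox1 (u : V) : V := (x1 * u.1.1, x1 * u.1.2, x1 * u.2).
pose ox2 (u : V) : V := (x2 * u.1.1, x2 * u.2, alpha^-1 *: (x2 * u.1.2)).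
pose oy1 (u : V) : V := (y1 * u.1.1, u.1.1, - (y1 * u.2)).
pose oy2 (u : V) : V := (y2 * u.1.1, - (y2 * u.1.2), u.1.1).
have [||||v|v|v|v|v|v|Phi [PhiL Phi1 Phig]] :=
  @universal V ox1 ox2 oy1 oy2 (1, 0, 0).
- by move=> c u v; apply: triple_ext; rewrite /= ?lin.
- move=> c u v; apply: triple_ext; rewrite /= ?lin //.
  by rewrite !scalerA mulrC.
- by move=> c u v; apply: triple_ext; rewrite /= ?lin.
- by move=> c u v; apply: triple_ext; rewrite /= ?lin.
- by apply: triple_ext; rewrite /= ?lin ?mulrA ?x2x1 ?mulNr ?scalerN.
- by apply: triple_ext; rewrite /= ?lin ?mulrA ?y2y1 ?mulNr.
- by apply: triple_ext; rewrite /= ?lin ?mulrA ?y1x1.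
- by apply: triple_ext; rewrite /= ?lin ?mulrA ?y1x2.
- by apply: triple_ext; rewrite /= ?lin ?mulrA ?y2x1.
- apply: triple_ext; rewrite /= ?lin ?mulrA ?y2x2 -?scalerAl //.
  by rewrite scalerA divff ?scale1r.
have PhiD a b : Phi (a + b) = Phi a + Phi b.
  by have := PhiL 1 a b; rewrite !scale1r.
have Phi11 b : (Phi b).1.1 = b.
  elim/ind: b => [|c a b IHa IHb|b IHb]; first by rewrite Phi1.
    by rewrite PhiL /= IHa IHb.
  by case: (Phig b) => -> -> -> ->; rewrite /= IHb.
exists (fun b => (Phi b).1.2), (fun b => (Phi b).2).
split=> [a b|a b|b|b|b]; rewrite ?PhiD //; case: (Phig b) => E1 E2 E3 E4.
- by split; rewrite ?E3 ?E4 /= ?Phi11.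
- by rewrite E1 E2.
by rewrite E1 E2.
Qed.

(** The right ideal generated by x1 and x2: the image of the differential of
    the Koszul complex of x1 and x2. *)
Definition x_ideal (b : B) := exists u1 u2, b = x1 * u1 + x2 * u2.

Lemma x_idealB a b : x_ideal a -> x_ideal b -> x_ideal (a - b).
Proof.
move=> [u1 [u2 ->]] [v1 [v2 ->]]; exists (u1 - v1), (u2 - v2).
by rewrite !mulrBr opprD addrACA.
Qed.

Let morph0 (D : B -> B) : {morph D : u v / u + v} -> D 0 = 0.
Proof. by move=> DD; apply: (addrI (D 0)); rewrite -DD !addr0. Qed.

Lemma x_regular c : x1 * c = 0 -> c = 0.
Proof.
have [D1 [D2 [D1D _ D11 _ _]]] := x_derivations => c0.
by rewrite -(D11 c) c0 morph0.
Qed.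

Lemma x_exact a b : x1 * a + x2 * b = 0 ->
  exists c, a = x2 * c /\ b = x1 * c.
Proof.
have [D1 [D2 [D1D D2D D11 D12 [_ D22]]]] := x_derivations => ab0.
have JB (u v : B) : u = 0 -> v = 0 -> u - v = 0 by move=> -> ->; rewrite subrr.
have Jz u : u = 0 -> x1 * u = 0 by move=> ->; rewrite mulr0.
have JD u : u = 0 -> D1 u = 0 /\ D2 u = 0 by move=> ->; rewrite !morph0.
have [c [/subr0_eq ac /subr0_eq bc]] :=
  skew_exact x2x1 D1D D11 D12 D22 JB Jz JD ab0.
by exists c.
Qed.

Lemma y_regular c : y1 * c = 0 -> c = 0.
Proof.
have [D1 [D2 [D1D _ Dy _ _]]] := y_derivations => c0.
by case: (Dy c) => <- _ _; rewrite c0 morph0.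
Qed.

Lemma y_exact a b : y1 * a + y2 * b = 0 ->
  exists c, a = y2 * c /\ b = y1 * c.
Proof.
have [D1 [D2 [D1D D2D Dy _ _]]] := y_derivations => ab0.
have D11 c : D1 (y1 * c) = c by case: (Dy c).
have D12 c : D1 (y2 * c) = - (y2 * D1 c) by case: (Dy c).
have D22 c : D2 (y2 * c) = c by case: (Dy c).
have JB (u v : B) : u = 0 -> v = 0 -> u - v = 0 by move=> -> ->; rewrite subrr.
have Jz u : u = 0 -> y1 * u = 0 by move=> ->; rewrite mulr0.
have JD u : u = 0 -> D1 u = 0 /\ D2 u = 0 by move=> ->; rewrite !morph0.
have [c [/subr0_eq ac /subr0_eq bc]] :=
  skew_exact y2y1 D1D D11 D12 D22 JB Jz JD ab0.
by exists c.
Qed.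

(** The division operators for y preserve [x_ideal], so that y1 and y2 form a
    regular pair on the quotient by it as well. *)
Lemma y_exact_mod_x a b : x_ideal (y1 * a + y2 * b) ->
  exists c, x_ideal (a - y2 * c) /\ x_ideal (b - y1 * c).
Proof.
have [D1 [D2 [D1D D2D Dy D1x D2x]]] := y_derivations.
have D11 c : D1 (y1 * c) = c by case: (Dy c).
have D12 c : D1 (y2 * c) = - (y2 * D1 c) by case: (Dy c).
have D22 c : D2 (y2 * c) = c by case: (Dy c).
apply: (skew_exact y2y1 D1D D11 D12 D22 x_idealB) => [_ [u1 [u2 ->]]|_ [u1 [u2 ->]]].
  exists (y1 * u1), (y2 * u2).
  by rewrite mulrDr !mulrA y1x1 y1x2.
split.
  exists (D1 u1), (D2 u2); rewrite D1D.
  by case: (D1x u1) (D1x u2) => -> _ [_ ->].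
exists (D2 u1), (alpha^-1 *: D1 u2); rewrite D2D mulZr.
by case: (D2x u1) (D2x u2) => -> _ [_ ->].
Qed.

Lemma y_regular_mod_x c : x_ideal (y2 * c) -> x_ideal c.
Proof.
have [D1 [D2 [D1D D2D Dy D1x D2x]]] := y_derivations.
move=> [u1 [u2 E]]; case: (Dy c) => _ _ <-; rewrite E.
exists (D2 u1), (alpha^-1 *: D1 u2); rewrite D2D mulZr.
by case: (D2x u1) (D2x u2) => -> _ [_ ->].
Qed.

End SkewDerivations.

(** * The total complex of two anticommuting chain maps *)

(** The complex 0 -> C2 -> C1 -> C0 with differentials t and e is exact except
    at C0. Two chain endomorphisms of it, with components y, Y and Z, anticommute
    in each degree and form a regular pair on its cokernel H. The total complex
      C2 -> C2^2 + C1 -> C2 + C1^2 + C0 -> C1 + C0^2 -> C0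
    is then exact, since its filtration by columns reduces it to the Koszul
    complex of the pair on H. Its cycles in degrees 1, 2, 3 are found one column
    at a time. *)
Section TotalComplex.
Variables (C0 C1 C2 : zmodType).
Variables (e : {additive C1 -> C0}) (t : {additive C2 -> C1}).
Variables (y1 y2 : {additive C0 -> C0}) (Y1 Y2 : {additive C1 -> C1}).
Variables (Z1 Z2 : {additive C2 -> C2}).
Hypothesis et : forall w, e (t w) = 0.
Hypothesis eY1 : forall u, e (Y1 u) = y1 (e u).
Hypothesis eY2 : forall u, e (Y2 u) = y2 (e u).
Hypothesis Y1t : forall w, Y1 (t w) = t (Z1 w).
Hypothesis Y2t : forall w, Y2 (t w) = t (Z2 w).
Hypothesis y21 : forall a, y2 (y1 a) = - y1 (y2 a).
Hypothesis Y21 : forall u, Y2 (Y1 u) = - Y1 (Y2 u).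
Hypothesis Z21 : forall w, Z2 (Z1 w) = - Z1 (Z2 w).
Hypothesis e_exact : forall u, e u = 0 -> exists w, u = t w.
Hypothesis t_inj : forall w, t w = 0 -> w = 0.
Hypothesis y_exact : forall a b u, y1 a + y2 b = e u ->
  exists c p q, a = e p + y2 c /\ b = e q + y1 c.
Hypothesis y_inj : forall c u, y2 c = e u -> exists r, c = e r.

Lemma tot_exact1 u a b : e u + y1 a + y2 b = 0 <->
  exists w p q c, [/\ u = t w - Y1 p - Y2 q, a = e p + y2 c & b = e q + y1 c].
Proof.
split=> [uab0|[w [p [q [c [-> -> ->]]]]]]; last first.
  rewrite !raddfB !raddfD /= et eY1 eY2 sub0r y21.
  by rewrite [X in X + _]addrACA addNr add0r addrACA addNr subrr addr0.
(* On the cokernel of e, the pair (a, b) is a cycle, hence a boundary of c;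
   what remains is a cycle of the complex C itself. *)
have [|c [p [q [aE bE]]]] := @y_exact a b (- u).
  by apply/eqP; rewrite raddfN -addr_eq0 addrC addrA uab0.
have [|w wE] := @e_exact (u + Y1 p + Y2 q).
  rewrite !raddfD /= eY1 eY2 -uab0 aE bE !raddfD /= y21.
  by rewrite addrA -!addrA; do 2!congr (_ + _); rewrite addrCA subrr addr0.
by exists w, p, q, c; split=> //; rewrite -wE addrAC addrK addrK.
Qed.

Lemma tot_exact2 w p q c :
  [/\ t w - Y1 p - Y2 q = 0, e p + y2 c = 0 & e q + y1 c = 0] <->
  exists m n r, [/\ w = Z1 m + Z2 n, p = t m - Y2 r, q = t n - Y1 r & c = e r].
Proof.
split=> [[w0 p0 q0]|[m [n [r [-> -> -> ->]]]]]; last first.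
  rewrite !raddfB !raddfD /= !et !eY1 !eY2 !Y1t !Y2t Y21 !sub0r !addNr opprK.
  split=> //.
  by rewrite [X in X + _]addrACA subrr add0r addrACA !subrr addr0.
have [|r cE] := @y_inj c (- p).
  by apply/eqP; rewrite raddfN -addr_eq0 addrC p0.
have [|m mE] := @e_exact (p + Y2 r); first by rewrite raddfD /= eY2 -cE.
have [|n nE] := @e_exact (q + Y1 r); first by rewrite raddfD /= eY1 -cE.
have pE : p = t m - Y2 r by rewrite -mE addrK.
have qE : q = t n - Y1 r by rewrite -nE addrK.
exists m, n, r; split=> //; apply/eqP; rewrite -subr_eq0; apply/eqP/t_inj.
rewrite -w0 pE qE !raddfB raddfD /= !Y1t !Y2t Y21.
by rewrite !opprK opprD -!addrA; do 2!congr (_ + _); rewrite addrCA subrr addr0.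
Qed.

Lemma tot_exact3 m n r :
  [/\ Z1 m + Z2 n = 0, t m - Y2 r = 0, t n - Y1 r = 0 & e r = 0] <->
  exists z, [/\ m = Z2 z, n = Z1 z & r = t z].
Proof.
split=> [[_ /subr0_eq tm /subr0_eq tn /e_exact[z rE]]|[z [-> -> ->]]].
  exists z; split=> //; apply/eqP; rewrite -subr_eq0; apply/eqP/t_inj.
    by rewrite raddfB /= tm rE Y2t subrr.
  by rewrite raddfB /= tn rE Y1t subrr.
by rewrite Y2t Y1t !subrr et Z21 subrr.
Qed.

End TotalComplex.

(** * Koszul complexes as tables of coefficients *)

(** Differentials are written as lists of rows, and vectors as lists, so that
    matrix identities of a given small size reduce by computation to one
    equation per row. *)
Section Tables.
Variable R : nzRingType.
Implicit Types (r s : seq R) (t : seq (seq R)).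

Fixpoint dot r s : R :=
  match r, s with a :: r', b :: s' => a * b + dot r' s' | _, _ => 0 end.

Definition tmul t s := [seq dot r s | r <- t].

Lemma size_tmul t s : size (tmul t s) = size t.
Proof. exact: size_map. Qed.

Definition table_mx m n t : 'M[R]_(m, n) :=
  \matrix_(i, j) nth 0 (nth [::] t i) j.

Definition cvec n s : 'cV[R]_n := \col_i nth 0 s i.

Definition cseq n (v : 'cV[R]_n) : seq R := [seq v i 0 | i <- enum 'I_n].

Lemma size_cseq n (v : 'cV[R]_n) : size (cseq v) = n.
Proof. by rewrite size_map size_enum_ord. Qed.

Lemma cseqK n (v : 'cV[R]_n) : cvec n (cseq v) = v.
Proof.
apply/matrixP => i j; rewrite ord1 mxE (nth_map i) ?size_enum_ord //.
by rewrite nth_ord_enum.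
Qed.

Lemma dotE n r s : size s = n -> dot r s = \sum_(j < n) nth 0 r j * nth 0 s j.
Proof.
elim: s n r => [|b s IHs] [|n] [|a r] //= => [_|_|[sn]|[sn]].
- by rewrite big_ord0.
- by rewrite big_ord0.
- by rewrite big1 // => j _; rewrite nth_nil mul0r.
by rewrite big_ord_recl /= (IHs n).
Qed.

Lemma table_mxM m n t s : size s = n ->
  table_mx m n t *m cvec n s = cvec m (tmul t s).
Proof.
move=> sn; apply/matrixP => i j; rewrite !mxE.
have -> : nth 0 (tmul t s) i = dot (nth [::] t i) s.
  case: (ltnP i (size t)) => it; first by rewrite (nth_map [::]).
  by rewrite !nth_default ?size_map.
by rewrite (dotE _ sn); apply: eq_bigr => k _; rewrite !mxE.
Qed.

Lemma cvec_inj n s s' : size s = n -> size s' = n ->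
  cvec n s = cvec n s' -> s = s'.
Proof.
move=> sn s'n E; apply: (@eq_from_nth _ 0); rewrite ?s'n // => i.
by rewrite sn => i_n; have /matrixP/(_ (Ordinal i_n) 0) := E; rewrite !mxE.
Qed.

Lemma cvec0 n : cvec n (nseq n 0) = 0.
Proof. by apply/matrixP => i j; rewrite !mxE nth_nseq; case: ifP. Qed.

Lemma table_exact m n k t t' : size t = m -> size t' = n ->
    (forall s, size s = n ->
      tmul t s = nseq m 0 <-> exists2 s', size s' = k & s = tmul t' s') ->
  forall v : 'cV_n,
    table_mx m n t *m v = 0 <-> exists w, v = table_mx n k t' *m w.
Proof.
move=> tm t'n ex v; rewrite -[v]cseqK table_mxM ?size_cseq //; split.
  move=> E; have /(ex _ (size_cseq v)) : tmul t (cseq v) = nseq m 0.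
    by apply: (@cvec_inj m); rewrite ?cvec0 // ?size_nseq ?size_tmul.
  case=> s' s'k ->.
  by exists (cvec k s'); rewrite table_mxM.
case=> w; rewrite -[w]cseqK table_mxM ?size_cseq // => E.
suff -> : tmul t (cseq v) = nseq m 0 by rewrite cvec0.
apply/(ex _ (size_cseq v)); exists (cseq w); first exact: size_cseq.
by apply: (@cvec_inj n); rewrite ?size_tmul ?size_cseq.
Qed.

(** The complex R -> R^2 -> R. The last table is that of the zero map from the
    zero module to R: one row, which is empty. *)
Definition pair_table (z1 z2 : R) : seq (seq (seq R)) :=
  [:: [:: [:: z1; z2]]; [:: [:: z2]; [:: z1]]; [:: [::]]].

Lemma pair_table_exact z1 z2 :
    z2 * z1 = - (z1 * z2) -> (forall c, z1 * c = 0 -> c = 0) ->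
    (forall a b, z1 * a + z2 * b = 0 -> exists c, a = z2 * c /\ b = z1 * c) ->
  forall i s, size s = nth 0 [:: 1; 2; 1] i.+1 ->
    tmul (nth [::] (pair_table z1 z2) i) s = nseq (nth 0%N [:: 1; 2; 1] i) 0 <->
    exists2 s', size s' = nth 0 [:: 1; 2; 1] i.+2
      & s = tmul (nth [::] (pair_table z1 z2) i.+1) s'.
Proof.
move=> z21 reg ex [|[|[|i]]].
- case=> [|a [|b []]] //= _; rewrite addr0; split.
    case=> /ex[c [-> ->]]; exists [:: c] => //.
    by rewrite /tmul /= !addr0.
  case=> [[|c [|c' s']]] //= _ [-> ->]; rewrite !addr0 !mulrA z21.
  by rewrite mulNr addrN.
- case=> [|c []] //= _; rewrite !addr0; split.
    by case=> _ /reg ->; exists [::].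
  by case=> s' _ [->]; rewrite !mulr0.
- by case=> //= _; split=> // _; exists [::].
by case=> [|c s] //=; rewrite !nth_nil // => _; split=> // _; exists [::].
Qed.

Lemma pair_table_entries (P : R -> Prop) z1 z2 :
    P 0 -> P z1 -> P z2 ->
  forall i a b, P (nth 0 (nth [::] (nth [::] (pair_table z1 z2) i) a) b).
Proof.
move=> P0 P1 P2 [|[|[|i]]] [|[|a]] [|[|b]] //=.
all: by rewrite ?nth_nil //= ?nth_nil.
Qed.

End Tables.

Section KoszulTables.
Variables (K : fieldType) (alpha : K) (B : algType K) (x1 x2 y1 y2 : B).

(** The total complex for y1, y2 acting on the Koszul complex of x1, x2. In
    degrees 1, 2, 3 a vector lists the coordinates that correspond to
      x1, x2, y1, y2;
      x1 x2, then x1 and x2 with y1, then x1 and x2 with y2, then y1 y2;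
      x1 x2 with y1, x1 x2 with y2, then x1 and x2 with y1 y2.
    On the top term of the Koszul complex of x1, x2 the elements y1, y2 act
    through z1 = y2 and z2 = alpha y1. *)
Definition koszul_table : seq (seq (seq B)) :=
  let: z1 := y2 in let: z2 := alpha *: y1 in
  [:: [:: [:: x1; x2; y1; y2]];
      [:: [:: x2; - y1; 0; - y2; 0; 0];
          [:: x1; 0; - y2; 0; - z2; 0];
          [:: 0; x1; x2; 0; 0; y2];
          [:: 0; 0; 0; x1; x2; y1]];
      [:: [:: z1; z2; 0; 0];
          [:: x2; 0; - y2; 0];
          [:: x1; 0; 0; - z2];
          [:: 0; x2; - y1; 0];
          [:: 0; x1; 0; - y2];
          [:: 0; 0; x1; x2]];
      [:: [:: z2]; [:: z1]; [:: x2]; [:: x1]];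
      [:: [::]]].

Hypothesis alpha_neq0 : alpha != 0.
Hypothesis pres : presented alpha x1 x2 y1 y2.

Let x2x1 := rel_x2x1 pres.
Let y2y1 := rel_y2y1 pres.
Let y1x1 := rel_y1x1 pres.
Let y1x2 := rel_y1x2 pres.
Let y2x1 := rel_y2x1 pres.
Let y2x2 := rel_y2x2 pres.

(** The Koszul complex of x1, x2, and the lifts of left multiplication by y1
    and y2 to it: y1 acts on its three terms through y1, diag(y1, y2), y2, and
    y2 through y2, diag(y2, alpha y1), alpha y1. *)
Definition xdiff1 (u : B * B) : B := x1 * u.1 + x2 * u.2.
Definition xdiff2 (w : B) : B * B := (x2 * w, x1 * w).
Definition left_mul (a b : B) : B := a * b.
Definition diag_mul (a b : B) (u : B * B) : B * B := (a * u.1, b * u.2).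

Let xdiff1_zmod : zmod_morphism xdiff1.
Proof. by move=> u v; rewrite /xdiff1 /= !mulrBr opprD addrACA. Qed.
Let xdiff2_zmod : zmod_morphism xdiff2.
Proof. by move=> u v; rewrite /xdiff2 /= !mulrBr. Qed.
Let left_mul_zmod a : zmod_morphism (left_mul a).
Proof. by move=> b c; apply: mulrBr. Qed.
Let diag_mul_zmod a b : zmod_morphism (diag_mul a b).
Proof. by move=> u v; rewrite /diag_mul /= !mulrBr. Qed.

HB.instance Definition _ :=
  GRing.isZmodMorphism.Build (B * B)%type B xdiff1 xdiff1_zmod.
HB.instance Definition _ :=
  GRing.isZmodMorphism.Build B (B * B)%type xdiff2 xdiff2_zmod.
HB.instance Definition _ a :=
  GRing.isZmodMorphism.Build B B (left_mul a) (left_mul_zmod a).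
HB.instance Definition _ a b :=
  GRing.isZmodMorphism.Build (B * B)%type (B * B)%type (diag_mul a b)
    (diag_mul_zmod a b).

Let xdiff12 w : xdiff1 (xdiff2 w) = 0.
Proof. by rewrite /xdiff1 /= !mulrA x2x1 mulNr addrN. Qed.

Let x1Y1 u : xdiff1 (diag_mul y1 y2 u) = left_mul y1 (xdiff1 u).
Proof. by rewrite /xdiff1 /left_mul /= mulrDr !mulrA y1x1 y1x2. Qed.

Let x1Y2 u : xdiff1 (diag_mul y2 (alpha *: y1) u) = left_mul y2 (xdiff1 u).
Proof.
by rewrite /xdiff1 /left_mul /= mulrDr !mulrA y2x1 y2x2 -!scalerAr.
Qed.

Let Y1x2 w : diag_mul y1 y2 (xdiff2 w) = xdiff2 (left_mul y2 w).
Proof. by rewrite /diag_mul /xdiff2 /left_mul /= !mulrA y1x2 y2x1. Qed.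

Let Y2x2 w :
  diag_mul y2 (alpha *: y1) (xdiff2 w) = xdiff2 (left_mul (alpha *: y1) w).
Proof.
rewrite /diag_mul /xdiff2 /left_mul /= !mulrA y2x2 -!scalerAl -!scalerAr y1x1.
by rewrite -!scalerAl.
Qed.

Let y_anti b : left_mul y2 (left_mul y1 b) = - left_mul y1 (left_mul y2 b).
Proof. by rewrite /left_mul !mulrA y2y1 mulNr. Qed.

Let z_anti b : left_mul (alpha *: y1) (left_mul y2 b) =
  - left_mul y2 (left_mul (alpha *: y1) b).
Proof.
rewrite /left_mul !mulrA -!scalerAl -!scalerAr y2y1 -!scalerAl mulNr scalerN.
by rewrite opprK.
Qed.

Let Y_anti u : diag_mul y2 (alpha *: y1) (diag_mul y1 y2 u) =
  - diag_mul y1 y2 (diag_mul y2 (alpha *: y1) u).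
Proof.
have E := z_anti u.2; have F := y_anti u.1; rewrite /left_mul in E F.
by rewrite /diag_mul /= E F.
Qed.

Let xdiff1_exact u : xdiff1 u = 0 -> exists w, u = xdiff2 w.
Proof. by case: u => a b /(x_exact pres)[c [/= -> ->]]; exists c. Qed.

Let xdiff2_inj w : xdiff2 w = 0 -> w = 0.
Proof. by case=> _ /(x_regular pres). Qed.

Let y_exact_mod a b u : left_mul y1 a + left_mul y2 b = xdiff1 u ->
  exists c p q, a = xdiff1 p + left_mul y2 c /\ b = xdiff1 q + left_mul y1 c.
Proof.
move=> E; have [|c [[p1 [p2 pE]] [q1 [q2 qE]]]] :=
  y_exact_mod_x alpha_neq0 pres (a := a) (b := b).
  by exists u.1, u.2.
exists c, (p1, p2), (q1, q2).
by rewrite /xdiff1 /left_mul /= -pE -qE !subrK.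
Qed.

Let y_inj_mod c u : left_mul y2 c = xdiff1 u -> exists r, c = xdiff1 r.
Proof.
move=> E; have [|r1 [r2 ->]] := y_regular_mod_x alpha_neq0 pres (c := c).
  by exists u.1, u.2.
by exists (r1, r2).
Qed.

Let koszul_exact1 :=
  tot_exact1 xdiff12 x1Y1 x1Y2 y_anti xdiff1_exact y_exact_mod.
Let koszul_exact2 :=
  tot_exact2 xdiff12 x1Y1 x1Y2 Y1x2 Y2x2 Y_anti xdiff1_exact xdiff2_inj
    y_inj_mod.
Let koszul_exact3 :=
  tot_exact3 xdiff12 Y1x2 Y2x2 z_anti xdiff1_exact xdiff2_inj.

Let simp := (@mul0r B, @add0r B, @addr0 B, @mulNr B, @addrA B).

Lemma koszul_table_exact i s : size s = nth 0 [:: 1; 4; 6; 4; 1] i.+1 ->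
  tmul (nth [::] koszul_table i) s = nseq (nth 0%N [:: 1; 4; 6; 4; 1] i) 0 <->
  exists2 s', size s' = nth 0 [:: 1; 4; 6; 4; 1] i.+2
    & s = tmul (nth [::] koszul_table i.+1) s'.
Proof.
case: i => [|[|[|[|[|i]]]]].
- case: s => [|u1 [|u2 [|a [|b []]]]] //= _.
  have [K1 K2] := koszul_exact1 (u1, u2) a b.
  rewrite /tmul /= !simp; split.
    case=> /K1[w [[p1 p2] [[q1 q2] [c [[-> ->] -> ->]]]]].
    by exists [:: w; p1; p2; q1; q2; c]; rewrite //= !simp.
  case=> -[|w [|p1 [|p2 [|q1 [|q2 [|c []]]]]]] //= _.
  rewrite !simp => -[E1 E2 E3 E4].
  congr [:: _]; apply: K2; exists w, (p1, p2), (q1, q2), c.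
  by rewrite E1 E2 E3 E4.
- case: s => [|w [|p1 [|p2 [|q1 [|q2 [|c []]]]]]] //= _.
  have [K1 K2] := koszul_exact2 w (p1, p2) (q1, q2) c.
  rewrite /tmul /= !simp; split.
    case=> E1 E2 E3 E4; have [|m [n [[r1 r2] [-> [-> ->] [-> ->] ->]]]] := K1.
      by split=> //; congr (_, _).
    by exists [:: m; n; r1; r2]; rewrite //= !simp.
  case=> -[|m [|n [|r1 [|r2 []]]]] //= _.
  rewrite !simp => -[E1 E2 E3 E4 E5 E6].
  have [|[F1 F2] F3 F4] := K2; last by congr [:: _; _; _; _].
  by exists m, n, (r1, r2); rewrite E1 E2 E3 E4 E5 E6.
- case: s => [|m [|n [|r1 [|r2 []]]]] //= _.
  have [K1 K2] := koszul_exact3 m n (r1, r2).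
  rewrite /tmul /= !simp; split.
    case=> E1 E2 E3 E4 E5 E6; have [|z [-> -> [-> ->]]] := K1.
      by split=> //; congr (_, _).
    by exists [:: z]; rewrite //= !simp.
  case=> -[|z []] //= _; rewrite !simp => -[E1 E2 E3 E4].
  have [|F1 [F2 F3] [F4 F5] F6] := K2; last by congr [:: _; _; _; _; _; _].
  by exists z; rewrite E1 E2 E3 E4.
- case: s => [|z []] //= _; rewrite /tmul /= !simp; split.
    by case=> _ _ _ /(x_regular pres) ->; exists [::].
  by case=> -[] //= _ [->]; rewrite !mulr0.
- by case: s => //= _; split=> // _; exists [::].
by case: s => [|c s] //=; rewrite !nth_nil // => _; split=> // _; exists [::].
Qed.

Lemma koszul_table_entries (P : B -> Prop) :
    P 0 -> (forall b, P b -> P (- b)) -> P (alpha *: y1) ->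
    P x1 -> P x2 -> P y1 -> P y2 ->
  forall i a b, P (nth 0 (nth [::] (nth [::] koszul_table i) a) b).
Proof.
move=> P0 PN Pay Px1 Px2 Py1 Py2.
move=> [|[|[|[|[|i]]]]] [|[|[|[|[|[|a]]]]]] [|[|[|[|[|[|b]]]]]] //=.
all: by rewrite ?nth_nil /= ?nth_nil; auto.
Qed.

End KoszulTables.

(** * Right ideals and the Betti numbers of the three modules *)

Section RightIdeals.
Variable R : nzRingType.

Lemma mem_gen_rideal (S : R -> Prop) b : S b -> b \in gen_rideal S.
Proof. by move=> Sb; apply/gen_ridealP => J _; apply. Qed.

Lemma gen_rideal_sub (S T : R -> Prop) :
    (forall z, S z -> z \in gen_rideal T) ->
  forall b, b \in gen_rideal S -> b \in gen_rideal T.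
Proof.
move=> ST b /gen_ridealP Sb; apply: (Sb (fun b => b \in gen_rideal T)) => //.
split=> [|u v|u v]; first exact: rpred0.
  exact: rpredB.
exact: gen_ridealM.
Qed.

Lemma gen_rideal_row (r : seq R) b : b \in gen_rideal [in r] <->
  exists2 s, size s = size r & [:: b] = tmul [:: r] s.
Proof.
split=> [/gen_ridealP Sb|[s sr [->]]]; last first.
  rewrite (dotE _ sr); apply: rpred_sum => j _.
  by apply/gen_ridealM/mem_gen_rideal/mem_nth.
suff [s sr ->] : exists2 s, size s = size r & b = dot r s by exists s.
apply: (Sb (fun b => exists2 s, size s = size r & b = dot r s)) => {b Sb}; last first.
  move=> z zr; have szz := size_mkseq (fun i => (i == index z r)%:R : R) (size r).
  exists (mkseq (fun i => (i == index z r)%:R) (size r)); first exact: szz.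
  have zi : (index z r < size r)%N by rewrite index_mem.
  rewrite (dotE _ szz) (bigD1 (Ordinal zi)) //= nth_mkseq // eqxx mulr1 nth_index //.
  rewrite big1 ?addr0 // => j /negPf jz; rewrite nth_mkseq //.
  by rewrite -val_eqE /= in jz; rewrite jz mulr0.
split=> [|_ _ [s sr ->] [s' s'r ->]|_ c [s sr ->]].
- exists (nseq (size r) 0); first by rewrite size_nseq.
  rewrite (dotE _ (size_nseq _ _)) big1 // => j _.
  by rewrite nth_nseq; case: ifP; rewrite mulr0.
- have sz := size_mkseq (fun i => nth 0 s i - nth 0 s' i) (size r).
  exists (mkseq (fun i => nth 0 s i - nth 0 s' i) (size r)); first exact: sz.
  rewrite (dotE _ sr) (dotE _ s'r) (dotE _ sz) -sumrB; apply: eq_bigr => j _.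
  by rewrite nth_mkseq // mulrBr.
have sz : size (map ( *%R^~ c) s) = size r by rewrite size_map.
exists (map ( *%R^~ c) s); first exact: sz.
rewrite (dotE _ sr) (dotE _ sz) mulr_suml; apply: eq_bigr => j _.
by rewrite (nth_map 0) ?sr // mulrA.
Qed.

Lemma mem_quad (P : R -> Prop) a b c d :
  P a -> P b -> P c -> P d -> forall z, z \in [:: a; b; c; d] -> P z.
Proof. by move=> ? ? ? ? z; rewrite !inE => /or4P[] /eqP ->. Qed.

Lemma mem_pair (P : R -> Prop) a b :
  P a -> P b -> forall z, z \in [:: a; b] -> P z.
Proof. by move=> ? ? z; rewrite !inE => /orP[] /eqP ->. Qed.

End RightIdeals.

Section GradedBK.
Variables (K : fieldType) (alpha : K).

Lemma BK_grading : grading (@BK_homog K alpha) (@BK_comp K alpha).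
Proof.
split=> [j|j r|i j r|r|j e a b [f fe ->]].
- exact: BK_compD.
- exact: BK_comp_homog.
- exact: BK_comp_id.
- exact: BK_sum.
rewrite -[b]BK_piK -BK_piM !BK_compE.
by rewrite (free4_compMl _ _ fe) BK_piM.
Qed.

Lemma BK_eps_homog j (r : BK alpha) : BK_homog j r -> j != 0 -> BK_eps r = 0.
Proof.
case=> f fj -> j0; rewrite BK_epsE.
case: (msuppP f mone) => [/fj|//]; rewrite fdeg1 => j1.
by rewrite -j1 eqxx in j0.
Qed.

(** A cyclic module has a linear resolution as soon as its relations are spanned
    by the row of the first table and the tables are exact. *)
Section TableResolution.
Variables (S : BK alpha -> Prop).
Variable homS : forall b, S b -> exists j, BK_homog j b.
Variables (ranks : seq nat) (tables : seq (seq (seq (BK alpha)))).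
(* The rank in degree zero is 1 by definition, not only provably: the vectors
   of the 0-th term are then those that the augmentation expects. *)
Let rank i := nth 0%N (1%N :: ranks) i.
Let table i := nth [::] tables i.
Hypothesis table_homog :
  forall i a b, BK_homog 1 (nth 0 (nth [::] (table i) a) b).
Hypothesis table_size : forall i, size (table i) = rank i.
Hypothesis table_gen : forall b, b \in gen_rideal S <->
  exists2 s, size s = rank 1 & [:: b] = tmul (table 0) s.
Hypothesis tables_exact : forall i s, size s = rank i.+1 ->
  tmul (table i) s = nseq (rank i) 0 <->
  exists2 s', size s' = rank i.+2 & s = tmul (table i.+1) s'.

Let M := cyclic_gmodule homS.
Let tdiff i : 'M[BK alpha]_(rank i, rank i.+1) := table_mx _ _ (table i).
Let tdeg i (_ : 'I_(rank i)) : int := i%:Z.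
Let taug (_ : 'I_1) : M := cyclic_pi S 1.

Let cyclic_gen_sum (v : 'cV[BK alpha]_1) :
  \sum_a (v a 0 : (BK alpha)^c) *: taug a = cyclic_pi S (v 0 0).
Proof. by rewrite big_ord1 /taug cyclic_scaleE mul1r. Qed.

Lemma BK_homog1 : BK_homog 0 (1 : BK alpha).
Proof.
exists 1; last by [].
by move=> w; rewrite msuppU1 in_fset1 => /eqP ->; rewrite fdeg1.
Qed.

Lemma table_resolution : exists F : free_resolution M,
  grank F = rank /\ forall i (a : 'I_(grank F i)), gdeg a = i%:Z.
Proof.
have h1 (a : 'I_(rank 0)) : gpart (tdeg a) (taug a).
  by exists 1 => //; apply: BK_homog1.
have h2 i (a : 'I_(rank i)) (b : 'I_(rank i.+1)) :
    BK_homog (tdeg b - tdeg a) (tdiff i a b).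
  by rewrite mxE /tdeg intS addrK; apply: table_homog.
have h3 (m : M) : exists v : 'cV[BK alpha]_1,
    m = \sum_a (v a 0 : (BK alpha)^c) *: taug a.
  exists (\col_i repr m); rewrite cyclic_gen_sum mxE.
  by apply/esym/cyclic_piK.
have h4 (v : 'cV[BK alpha]_1) : \sum_a (v a 0 : (BK alpha)^c) *: taug a = 0 <->
    exists w, v = tdiff 0 *m w.
  rewrite cyclic_gen_sum -(cyclic_pi0 S).
  have -> : cyclic_pi S (v 0 0) = cyclic_pi S 0 <-> v 0 0 \in gen_rideal S.
    by rewrite -{2}[v 0 0]subr0; split=> /cyclic_piP.
  rewrite table_gen; split=> [[s sr E]|[w ->]].
    exists (cvec _ s); rewrite table_mxM // -E.
    by apply/matrixP => i j; rewrite !mxE !ord1.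
  exists (cseq w); first exact: size_cseq.
  rewrite -{1}[w]cseqK table_mxM ?size_cseq // mxE.
  by case: (table 0) (table_size 0) => [|r []].
have h5 i (v : 'cV[BK alpha]_(rank i.+1)) :
    tdiff i *m v = 0 <-> exists w, v = tdiff i.+1 *m w.
  exact: table_exact (table_size i) (table_size i.+1) (tables_exact (i := i)) v.
by exists (FreeResolution h1 h2 h3 h4 h5).
Qed.

Lemma betti_table i j :
  betti (@BK_eps K alpha) M i j = if j == i%:Z then rank i else 0%N.
Proof.
have [F [<- lin]] := table_resolution.
exact: (betti_linear BK_grading BK_eps_homog i j lin).
Qed.

End TableResolution.

Hypothesis alpha_neq0 : alpha != 0.
Local Notation B := (BK alpha).
Local Notation X1 := (BK_x1 alpha).
Local Notation X2 := (BK_x2 alpha).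
Local Notation Y1 := (BK_y1 alpha).
Local Notation Y2 := (BK_y2 alpha).

Let homog_gen : [/\ BK_homog 1 X1, BK_homog 1 X2, BK_homog 1 Y1 & BK_homog 1 Y2].
Proof. by split; apply: BK_letter_homog. Qed.

Lemma BK_epsZ (c : K) (b : B) : BK_eps (c *: b) = c * BK_eps b.
Proof. by rewrite -[b]BK_piK -BK_piZ !BK_epsE mcoeffZ. Qed.

Lemma BK_eps_gen1 (a b : B) : BK_homog 1 a -> BK_eps (a * b) = 0.
Proof. by move=> ah; rewrite rmorphM /= (BK_eps_homog ah) // mul0r. Qed.

Let gens : seq B := [:: X1; X2; Y1; Y2].

(** By induction on b: a product with a generator on its left lies in the right
    ideal of the generators and has augmentation zero. So the augmentation ideal
    is generated by them as a right ideal. *)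
Lemma BK_eps_gen (b : B) : b - BK_eps b *: 1 \in gen_rideal [in gens].
Proof.
have [hx1 hx2 hy1 hy2] := homog_gen.
apply: (BK_ind (P := fun b => b - BK_eps b *: 1 \in gen_rideal [in gens])) b
  => [|c a b Ia Ib|b _].
- by rewrite rmorph1 scale1r subrr rpred0.
- have -> : c *: a + b - BK_eps (c *: a + b) *: 1 =
      (a - BK_eps a *: 1) * c%:A + (b - BK_eps b *: 1).
    rewrite rmorphD /= BK_epsZ mulr_algr scalerDl opprD addrACA.
    by rewrite scalerBr scalerA.
  exact: rpredD (gen_ridealM _ Ia) Ib.
have gen k : (k < 4)%N -> nth 0 gens k * b \in gen_rideal [in gens].
  by move=> k4; apply/gen_ridealM/mem_gen_rideal/mem_nth.
split; rewrite BK_eps_gen1 // scale0r subr0.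
- exact: (gen 0).
- exact: (gen 1).
- exact: (gen 2).
- exact: (gen 3).
Qed.

Lemma pos_gen (b : B) : b \in gen_rideal (@BK_pos K alpha) <->
  exists2 s, size s = 4 & [:: b] = tmul [:: gens] s.
Proof.
have [hx1 hx2 hy1 hy2] := homog_gen.
rewrite -(gen_rideal_row gens); split; apply: gen_rideal_sub.
  move=> z [n n0 zn]; have := BK_eps_gen z.
  by rewrite (BK_eps_homog zn) ?scale0r ?subr0 //; case: (n) n0.
have pos1 z : BK_homog 1 z -> z \in gen_rideal (@BK_pos K alpha).
  by move=> zh; apply: mem_gen_rideal; exists 1%N.
by apply: mem_quad; apply: pos1.
Qed.

Lemma xs_gen (b : B) : b \in gen_rideal (@BK_xs K alpha) <->
  exists2 s, size s = 2 & [:: b] = tmul [:: [:: X1; X2]] s.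
Proof.
rewrite -(gen_rideal_row [:: X1; X2]); split; apply: gen_rideal_sub.
  move=> z zs; apply/mem_gen_rideal; case: zs => ->.
    exact: (@mem_nth _ 0 [:: X1; X2] 0).
  exact: (@mem_nth _ 0 [:: X1; X2] 1).
by apply: mem_pair; apply: mem_gen_rideal; [left|right].
Qed.

Lemma ys_gen (b : B) : b \in gen_rideal (@BK_ys K alpha) <->
  exists2 s, size s = 2 & [:: b] = tmul [:: [:: Y1; Y2]] s.
Proof.
rewrite -(gen_rideal_row [:: Y1; Y2]); split; apply: gen_rideal_sub.
  move=> z zs; apply/mem_gen_rideal; case: zs => ->.
    exact: (@mem_nth _ 0 [:: Y1; Y2] 0).
  exact: (@mem_nth _ 0 [:: Y1; Y2] 1).
by apply: mem_pair; apply: mem_gen_rideal; [left|right].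
Qed.

Lemma BK_homogN j (b : B) : BK_homog j b -> BK_homog j (- b).
Proof.
by move=> bh; rewrite -[- b]sub0r; apply: BK_homogB bh; apply: BK_homog0.
Qed.

Lemma BK_homogZ j c (b : B) : BK_homog j b -> BK_homog j (c *: b).
Proof.
case=> f fj ->; exists (c *: f); last by rewrite BK_piZ.
exact: free4_homogZ.
Qed.

Let pres := BK_presented alpha.

Lemma betti_k_B i j : betti (@BK_eps K alpha) (k_B alpha) i j =
  if j == i%:Z then nth 0%N [:: 1; 4; 6; 4; 1]%N i else 0%N.
Proof.
have [hx1 hx2 hy1 hy2] := homog_gen.
pose T := koszul_table alpha X1 X2 Y1 Y2.
apply: (@betti_table _ (@BK_pos_homog K alpha) [:: 4; 6; 4; 1]%N T).
- exact: (koszul_table_entries (BK_homog0 alpha 1) (@BK_homogN 1)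
    (BK_homogZ alpha hy1) hx1 hx2 hy1 hy2).
- by case=> [|[|[|[|[|k]]]]]; rewrite /= ?nth_nil.
- exact: pos_gen.
- exact: koszul_table_exact alpha_neq0 pres.
Qed.

Lemma betti_M_x i j : betti (@BK_eps K alpha) (M_x alpha) i j =
  if j == i%:Z then nth 0%N [:: 1; 2; 1]%N i else 0%N.
Proof.
have [hx1 hx2 hy1 hy2] := homog_gen.
apply: (@betti_table _ (@BK_xs_homog K alpha) [:: 2; 1]%N (pair_table X1 X2)).
- by apply: pair_table_entries => //; apply: BK_homog0.
- by case=> [|[|[|k]]]; rewrite /= ?nth_nil.
- exact: xs_gen.
- exact: pair_table_exact (rel_x2x1 pres) (x_regular pres) (x_exact pres).
Qed.

Lemma betti_M_y i j : betti (@BK_eps K alpha) (M_y alpha) i j =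
  if j == i%:Z then nth 0%N [:: 1; 2; 1]%N i else 0%N.
Proof.
have [hx1 hx2 hy1 hy2] := homog_gen.
apply: (@betti_table _ (@BK_ys_homog K alpha) [:: 2; 1]%N (pair_table Y1 Y2)).
- by apply: pair_table_entries => //; apply: BK_homog0.
- by case=> [|[|[|k]]]; rewrite /= ?nth_nil.
- exact: ys_gen.
exact: pair_table_exact (rel_y2y1 pres) (y_regular alpha_neq0 pres)
  (y_exact alpha_neq0 pres).
Qed.

End GradedBK.

(** * Generating polynomials *)

Lemma coef_st_diagonal (c : seq nat) i j :
  coef_st (\sum_(k < size c) (svar ^+ k * tvar ^+ k) *+ nth 0%N c k) i j =
  (if j == i%:Z then nth 0%N c i else 0%N)%:Z.
Proof.
have coefk k n : ((svar ^+ k * tvar ^+ k) *+ nth 0%N c k)`_i`_n =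
    if (k == i) && (n == i) then (nth 0%N c i)%:Z else 0.
  rewrite coefMn -polyC_exp coefMC coefXn coefMn eq_sym.
  case: (eqVneq k i) => [->|_]; last by rewrite mul0r coef0 mul0rn.
  rewrite mul1r coefXn; case: eqP => _; last by rewrite mul0rn.
  by rewrite -natz.
case: j => n; last by [].
rewrite /coef_st !coef_sum; under eq_bigr do rewrite coefk.
rewrite eqz_nat; case: (eqVneq n i) => [_|_]; last first.
  by rewrite big1 // => k _; rewrite andbF.
under eq_bigr do rewrite andbT.
case: (ltnP i (size c)) => ic.
  rewrite (bigD1 (Ordinal ic)) //= eqxx big1 ?addr0 // => k /negPf.
  by rewrite -val_eqE /= => ->.
rewrite nth_default // big1 // => k _.
by case: eqP => // ki; have := ltn_ord k; rewrite ki ltnNge ic.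
Qed.

Theorem corollary5p2 (K : fieldType) (alpha : K) (halpha : alpha != 0) :
  let s := svar in
  let t := tvar in
  let P := poincare (@BK_eps K alpha) in
  [/\ P (k_B alpha) =2 coef_st
         (1 + 4 * (s * t) + 6 * (s ^+ 2 * t ^+ 2) + 4 * (s ^+ 3 * t ^+ 3)
            + s ^+ 4 * t ^+ 4),
      1 + 4 * (s * t) + 6 * (s ^+ 2 * t ^+ 2) + 4 * (s ^+ 3 * t ^+ 3)
            + s ^+ 4 * t ^+ 4 = (1 + s * t) ^+ 4,
      P (M_x alpha) =2 coef_st (1 + 2 * (s * t) + s ^+ 2 * t ^+ 2),
      P (M_y alpha) =2 coef_st (1 + 2 * (s * t) + s ^+ 2 * t ^+ 2)
    & 1 + 2 * (s * t) + s ^+ 2 * t ^+ 2 = (1 + s * t) ^+ 2].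
Proof.
move=> s t P; split; try (by ring).
- move=> i j; rewrite /P /poincare betti_k_B // -(coef_st_diagonal [:: 1; 4; 6; 4; 1]%N).
  congr coef_st; rewrite /= !big_ord_recl big_ord0 /= /bump !leq0n !add1n.
  by rewrite /s /t; ring.
- move=> i j; rewrite /P /poincare betti_M_x // -(coef_st_diagonal [:: 1; 2; 1]%N).
  congr coef_st; rewrite /= !big_ord_recl big_ord0 /= /bump !leq0n !add1n.
  by rewrite /s /t; ring.
- move=> i j; rewrite /P /poincare betti_M_y // -(coef_st_diagonal [:: 1; 2; 1]%N).
  congr coef_st; rewrite /= !big_ord_recl big_ord0 /= /bump !leq0n !add1n.
  by rewrite /s /t; ring.
Qed.
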